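(* Let $\Lambda\subset\mathbb{R}^d$ be a lattice. The jittered sampling point process on $\Omega_\Lambda$ (associated with area-regular partitions of $\Omega_\Lambda$ into $N$ parts of diameter at most $CN^{-1/d}$, $C$ independent of $N$) is hyperuniform in all three regimes: for large balls, for small balls and for balls of threshold order.
   Context: Let $\Lambda=A\mathbb{Z}^d$ be a lattice in $\mathbb{R}^d$, generated by a nonsingular matrix $A=[v_1,\dots,v_d]$, with fundamental domain $\Omega_\Lambda=\{\sum_{j=1}^d\alpha_jv_j:\alpha_j\in[0,1)\}$ of $\mathbb{R}^d/\Lambda$ and co-volume $|\Lambda|=|\det A|$. Let $\mu$ be Lebesgue measure on $\Omega_\Lambda$ normalized so that $\mu(\Omega_\Lambda)=1$, and let $\mathrm{diam}$ denote Euclidean diameter. Jittered sampling: for each $N\in\mathbb{N}$ let $\mathcal{A}=\{A_1,\dots,A_N\}$ (depending on $N$) be a partition of $\Omega_\Lambda$ into pairwise disjoint measurable sets, $\bigcup_{j=1}^NA_j=\Omega_\Lambda$, that is area-regular, i.e. $\mu(A_j)=\frac1N$ for all $j$, and satisfies $\mathrm{diam}(A_j)\le CN^{-1/d}$ for $j=1,\dots,N$ with a constant $C$ not depending on $N$. Let $\mu_j(\cdot)=N\mu(\cdot\cap A_j)$, a probability measure. The jittered sampling point process consists of $N$ independent random points $\mathbf{x}_1,\dots,\mathbf{x}_N$, where $\mathbf{x}_j\in A_j$ has law $\mu_j$. Balls on the torus: indicator functions of balls are $\Lambda$-periodized, i.e. for $\mathbf{x},\mathbf{y}\in\mathbb{R}^d$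 and $R\ge 0$ put $\mathbb{1}_{B(\mathbf{x},R)}(\mathbf{y})=\#\{v\in\Lambda:|\mathbf{y}+v-\mathbf{x}|\le R\}$, and $\mathrm{Vol}(B(\mathbf{x},R))=\frac{1}{|\Lambda|}\frac{\pi^{d/2}}{\Gamma(d/2+1)}R^d$. Number variance of the process: $$V(X_N,R)=\int_{\Omega_\Lambda}\int_{A_1}\cdots\int_{A_N}\Big(\sum_{j=1}^N\mathbb{1}_{B(\mathbf{x},R)}(\mathbf{x}_j)-N\,\mathrm{Vol}(B(\mathbf{x},R))\Big)^2d\mu_1(\mathbf{x}_1)\cdots d\mu_N(\mathbf{x}_N)\,d\mu(\mathbf{x}).$$ With this $V$, the process is: - hyperuniform for large balls if $V(X_N,R)=o(N)$ as $N\to\infty$ for every $R\in(0,\frac12\mathrm{diam}\,\Omega_\Lambda)$; - hyperuniform for small balls if $V(X_N,R_N)=o(N\,\mathrm{Vol}(B(\cdot,R_N)))$ as $N\to\infty$ for all sequences of positive radii $(R_N)$ with $R_N\to0$ and $N\,\mathrm{Vol}(B(\cdot,R_N))\to\infty$; - hyperuniform for balls of threshold order if $\limsup_{N\to\infty}V(X_N,tN^{-1/d})=\mathcal{O}(t^{d-1})$ as $t\to\infty$. *)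

(* Defs.v *)
From HB Require Import structures.
From mathcomp Require Import all_boot all_order all_algebra finmap.
From mathcomp Require Import all_classical all_reals all_analysis.

Set Implicit Arguments.
Unset Strict Implicit.
Unset Printing Implicit Defensive.

Import Order.TTheory GRing.Theory Num.Theory.
Import numFieldNormedType.Exports.

Local Open Scope classical_set_scope.
Local Open Scope ring_scope.

Definition measure_cV_display : measure_display.
Proof. by constructor. Qed.

Section measurable_cV.
Context {R : realType} (n : nat).

Definition cV_coord (i : 'I_n) (v : 'cV[R]_n) : measurableTypeR R := v i ord0.

Let cV_set0 : g_sigma_preimage cV_coord set0.
Proof. exact: sigma_algebra0. Qed.

Let cV_setC E : g_sigma_preimage cV_coord E -> g_sigma_preimage cV_coord (~` E).
Proof. exact: sigma_algebraC. Qed.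

Let cV_bigcup (F : (set 'cV[R]_n)^nat) :
  (forall i, g_sigma_preimage cV_coord (F i)) ->
  g_sigma_preimage cV_coord (\bigcup_i F i).
Proof. exact: sigma_algebra_bigcup. Qed.

(* The Borel sigma-algebra of R^n, generated by the coordinates. *)
HB.instance Definition _ := @isMeasurable.Build measure_cV_display
  'cV[R]_n (g_sigma_preimage cV_coord) cV_set0 cV_setC cV_bigcup.

Lemma measurable_cV_coord i : measurable_fun [set: 'cV[R]_n] (cV_coord i).
Proof.
move=> _ Y mY; rewrite setTI; apply: sub_sigma_algebra => /=.
rewrite -bigcup_seq/=; exists i => /=; first by rewrite mem_index_enum.
by exists Y => //; rewrite setTI.
Qed.

Lemma measurable_fun_cVP d (T : measurableType d) (f : T -> 'cV[R]_n) :
  (forall i, measurable_fun setT (cV_coord i \o f)) -> measurable_fun setT f.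
Proof.
move=> mf.
have sub : g_sigma_preimage (fun i => cV_coord i \o f) `<=` measurable.
  apply: smallest_sub; first exact: sigma_algebra_measurable.
  rewrite -bigcup_seq => E [i _] [Y mY <-].
  exact: mf.
move: sub; rewrite g_sigma_preimage_comp => sub _ E mE.
by apply: sub; exists E.
Qed.

End measurable_cV.

Section cons_measure.
Context {R : realType} (n : nat).

Definition cV_cons (p : measurableTypeR R * 'cV[R]_n) : 'cV[R]_n.+1 :=
  \col_i (if unlift ord0 i is Some j then p.2 j ord0 else p.1 : R).

Definition cV_uncons (v : 'cV[R]_n.+1) : measurableTypeR R * 'cV[R]_n :=
  (v ord0 ord0, \col_j v (lift ord0 j) ord0).

Lemma cV_consK : cancel cV_cons cV_uncons.
Proof.
case=> x v; rewrite /cV_uncons mxE unlift_none; congr (_, _).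
by apply/colP => j; rewrite !mxE liftK.
Qed.

Lemma measurable_cV_cons : measurable_fun setT cV_cons.
Proof.
apply: measurable_fun_cVP => i.
have [j ->|->] := unliftP ord0 i.
- rewrite (_ : _ \o _ = cV_coord j \o snd).
    by apply: measurableT_comp => //; exact: measurable_cV_coord.
  by apply/funext => p /=; rewrite /cV_coord mxE liftK.
- rewrite (_ : _ \o _ = fst) //.
  by apply/funext => p /=; rewrite /cV_coord mxE unlift_none.
Qed.

Lemma measurable_cV_uncons : measurable_fun setT cV_uncons.
Proof.
apply: measurable_fun_pair; first exact: (@measurable_cV_coord R n.+1 ord0).
apply: measurable_fun_cVP => j.
rewrite (_ : _ \o _ = cV_coord (lift ord0 j)).
  exact: measurable_cV_coord.
by apply/funext => v /=; rewrite /cV_coord mxE.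
Qed.

Variable m : {sigma_finite_measure set 'cV[R]_n -> \bar R}.

Definition cons_measure : set 'cV[R]_n.+1 -> \bar R :=
  pushforward (@lebesgue_measure R \x m)%E cV_cons.

Let cons_measure0 : cons_measure set0 = 0%E.
Proof. by rewrite /cons_measure /pushforward preimage_set0 measure0. Qed.

Let cons_measure_ge0 E : (0 <= cons_measure E)%E.
Proof. exact: (measure_ge0 (lebesgue_measure \x m)%E). Qed.

Let cons_measure_sigma_additive : semi_sigma_additive cons_measure.
Proof.
have mpre E : measurable E -> measurable (cV_cons @^-1` E).
  by move=> mE; rewrite -[X in measurable X]setTI; exact: measurable_cV_cons.
move=> F mF tF mUF; rewrite /cons_measure /pushforward preimage_bigcup.
apply: measure_semi_sigma_additive.
- by move=> k; exact: mpre.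
- apply/trivIsetP => /= i j _ _ ij; rewrite -preimage_setI.
  by move/trivIsetP : tF => /(_ _ _ _ _ ij) ->//; rewrite preimage_set0.
- by rewrite -preimage_bigcup; exact: mpre.
Qed.

HB.instance Definition _ := isMeasure.Build _ _ _ cons_measure
  cons_measure0 cons_measure_ge0 cons_measure_sigma_additive.

Let cons_measure_sigma_finite : sigma_finite setT cons_measure.
Proof.
have /sigma_finiteP[F [FT ndF Foo]] := sigma_finiteT (@lebesgue_measure R).
have /sigma_finiteP[G [GT ndG Goo]] := sigma_finiteT m.
exists (fun k => cV_uncons @^-1` (F k `*` G k)).
  rewrite -preimage_bigcup (_ : \bigcup_k _ = setT) ?preimage_setT//.
  rewrite -setXTT FT GT predeqE => -[x y]; split.
    by move=> [k _ []/= ? ?]; split; exists k.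
  move=> [/= [k _ Fkx] [l _ Gly]]; exists (maxn k l) => //; split.
  - by move: x Fkx; exact/subsetPset/ndF/leq_maxl.
  - by move: y Gly; exact/subsetPset/ndG/leq_maxr.
move=> k; have [mF Fk] := Foo k; have [mG Gk] := Goo k.
have mFG : measurable (F k `*` G k) by exact: measurableX.
split.
  by rewrite -[X in measurable X]setTI; exact: measurable_cV_uncons.
rewrite /cons_measure /pushforward -comp_preimage.
rewrite (_ : _ \o _ = id); last by apply/funext => p; exact: cV_consK.
rewrite preimage_id.
apply: (@le_lt_trans _ _ (lebesgue_measure (F k) * m (G k))%E).
  by rewrite -(product_measure1E _ _ mF mG).
by rewrite lte_mul_pinfty// ge0_fin_numE.
Qed.

HB.instance Definition _ := Measure_isSigmaFinite.Build _ _ _ cons_measure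
  cons_measure_sigma_finite.

End cons_measure.

(* n-fold product of the Lebesgue measure on R, on the Borel sets of R^n. *)
Fixpoint borel_lebesgue (R : realType) (n : nat) :
    {sigma_finite_measure set 'cV[R]_n -> \bar R} :=
  match n with
  | 0 => [the {sigma_finite_measure set 'cV[R]_0 -> \bar R}
           of @dirac _ 'cV[R]_0 0 R]
  | k.+1 => [the {sigma_finite_measure set 'cV[R]_k.+1 -> \bar R}
           of cons_measure (borel_lebesgue R k)]
  end.

(* R^n equipped with the sigma-algebra of Lebesgue-measurable sets, and the
   (complete) Lebesgue measure on it. *)
Definition Rn (R : realType) (n : nat) : measurableType _ :=
  caratheodory_type ((borel_lebesgue R n)^*)%mu.

Definition lebesgue_Rn (R : realType) (n : nat) : set (Rn R n) -> \bar R :=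
  @completed_measure_extension _ _ _ (borel_lebesgue R n).

HB.instance Definition _ (R : realType) (n : nat) :=
  Measure.on (@lebesgue_Rn R n).

Section euclidean.
Context {R : realType} {n : nat}.

(* The library norm on matrices is the sup norm. *)
Definition enorm (v : 'cV[R]_n) : R := Num.sqrt (\sum_i v i ord0 ^+ 2).

Definition diam (E : set 'cV[R]_n) : \bar R :=
  ereal_sup [set (enorm (x - y))%:E | x in E & y in E].

End euclidean.

Definition Gamma {R : realType} (z : R) : R :=
  \int[@lebesgue_measure R]_(t in `]0, +oo[) (t `^ (z - 1) * expR (- t)).

Section lattice.
Context {R : realType} {d : nat} (A : 'M[R]_d).

Definition lattice : set 'cV[R]_d :=
  [set A *m map_mx intr z | z in [set: 'cV[int]_d]].

Definition fund_domain : set 'cV[R]_d :=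
  [set A *m a | a in [set a : 'cV[R]_d | forall j, 0 <= a j ord0 < 1]].

Definition covolume : R := `|\det A|.

Definition torus_measure (E : set (Rn R d)) : \bar R :=
  (((fine (lebesgue_Rn fund_domain))^-1)%:E *
   lebesgue_Rn (E `&` fund_domain))%E.

(* [fset_set] sends infinite sets to the empty set, but the set below is finite
   as soon as A is nonsingular. *)
Definition ball_indicator (x : 'cV[R]_d) (r : R) (y : 'cV[R]_d) : R :=
  (#|` fset_set [set v | lattice v /\ enorm (y + v - x) <= r]|)%:R.

Definition ball_volume (r : R) : R :=
  covolume^-1 * (pi `^ (d%:R / 2) / Gamma (d%:R / 2 + 1)) * r ^+ d.

End lattice.

Section iterated_integral.
Context {R : realType} {disp : measure_display} {T : measurableType disp}.
Local Open Scope ereal_scope.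

Fixpoint iterated_integral (N : nat) : ('I_N -> set T -> \bar R) ->
    ('I_N -> set T) -> (N.-tuple T -> \bar R) -> \bar R :=
  match N with
  | 0 => fun _ _ f => f [tuple]
  | k.+1 => fun nu D f => \int[nu ord0]_(x in D ord0)
      iterated_integral (fun j => nu (lift ord0 j)) (fun j => D (lift ord0 j))
        (fun s => f [tuple of x :: s])
  end.

End iterated_integral.

Section jittered_sampling.
Context {R : realType} {d : nat} (A : 'M[R]_d).

Definition area_regular_partition (C : R) (N : nat) (P : 'I_N -> set (Rn R d)) :
    Prop :=
  [/\ forall j, measurable (P j),
      trivIset setT P,
      \bigcup_j P j = fund_domain A,
      forall j, torus_measure A (P j) = (N%:R^-1)%:E &
      forall j, (diam (P j) <= (C * N%:R `^ (- d%:R^-1))%:E)%E].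

Definition jittered_law (N : nat) (P : 'I_N -> set (Rn R d)) (j : 'I_N)
    (E : set (Rn R d)) : \bar R :=
  (N%:R%:E * torus_measure A (E `&` P j))%E.

Definition number_variance (N : nat) (P : 'I_N -> set (Rn R d)) (r : R) :
    \bar R :=
  (\int[torus_measure A]_(x in fund_domain A)
     iterated_integral (jittered_law P) P (fun s =>
       ((\sum_(j < N) ball_indicator A x r (tnth s j)
         - N%:R * ball_volume A r) ^+ 2)%:E))%E.

End jittered_sampling.

Section hyperuniformity.
Context {R : realType} {d : nat} (A : 'M[R]_d).

(* The number variance lives in \bar R, where Landau notations are not
   available, and [fine] would send an infinite variance to 0: hence the
   unfolded form of little-o here, and of big-O in [hyperuniform_threshold]. *)
Definition elittleo (u : nat -> \bar R) (v : nat -> R) : Prop :=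
  forall e : R, 0 < e -> \forall N \near \oo, (`|u N| <= (e * `|v N|)%:E)%E.

Definition hyperuniform_large_balls (V : nat -> R -> \bar R) : Prop :=
  forall r : R, 0 < r -> (r%:E < (2^-1)%:E * diam (fund_domain A))%E ->
    elittleo (fun N => V N r) (fun N => N%:R).

Definition hyperuniform_small_balls (V : nat -> R -> \bar R) : Prop :=
  forall r : nat -> R, (forall N, 0 < r N) -> r @ \oo --> 0 ->
    (fun N => N%:R * ball_volume A (r N)) @ \oo --> +oo ->
    elittleo (fun N => V N (r N)) (fun N => N%:R * ball_volume A (r N)).

Definition hyperuniform_threshold (V : nat -> R -> \bar R) : Prop :=
  exists K : R, \forall t \near +oo,
    (`|limn_esup (fun N => V N (t * N%:R `^ (- d%:R^-1))%R)|
       <= (K * `|t ^+ d.-1|)%:E)%E.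

End hyperuniformity.

Arguments hyperuniform_threshold {R} d V.

(* Main.v *)
(** The centred count has mean exactly [N * Vol(B)], because averaging over all
    cells is integrating over the torus; by independence the inner integral is
    therefore the sum over [j] of the variance of the ball indicator on the cell
    [A_j]. On a cell of diameter at most [e = C * N^(-1/d)] the indicator varies
    by at most the number [g_j(x)] of lattice translates of a fixed point of the
    cell lying in the annulus of radii [r - e] and [r + e] around [x]; for
    bounded radii [g_j <= M], so the variance is at most [M * g_j(x)]. Averaging
    over [x] unfolds the lattice sum into the volume of the annulus, hence
    [V(X_N, r) = O(N * e * (r + e)^(d-1))] uniformly for bounded [r], and each
    regime follows by inserting its radii.

    Two volumes must be known exactly for the mean to cancel: the covolume
    [|det A|] of the fundamental domain, from the linear change of variables
    (Fubini and Gaussian elimination), and the volume of the ball, from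
    integrating the Gaussian [exp(-|v|^2)] both as a product and in layers. *)

Require Import Defs.
From HB Require Import structures.
From mathcomp Require Import all_boot all_order all_algebra finmap.
From mathcomp Require Import all_classical all_reals all_analysis.
From mathcomp Require Import measurable_realfun ring lra.

Set Implicit Arguments.
Unset Strict Implicit.
Unset Printing Implicit Defensive.

Import Order.TTheory GRing.Theory Num.Theory.
Import numFieldNormedType.Exports.

Local Open Scope classical_set_scope.
Local Open Scope ring_scope.

(** * Affine change of variables on the real line *)

Section affine_substitution.
Context {R : realType}.
Implicit Types a b : R.
Notation mu := (@lebesgue_measure R).

Let affine a b : measurableTypeR R -> measurableTypeR R := fun x => a * x + b.

Lemma measurable_affine a b : measurable_fun setT (affine a b).
Proof. by apply: measurable_funD => //; exact: measurable_funM. Qed.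

Let affine_image a b : {measure set (measurableTypeR R) -> \bar R} :=
  mscale (NngNum (normr_ge0 a))
    (measure_function_pushforward__canonical__measure_function_Measure mu
      (measurable_affine a b)).

(** Uniqueness of Lebesgue measure: [affine_image], the pushforward under the affine map scaled by
    [|a|], gives every half-open interval its length. *)
Lemma lebesgue_measure_affine a b (E : set (measurableTypeR R)) : a != 0 ->
  measurable E -> mu E = (`|a|%:E * mu (affine a b @^-1` E))%E.
Proof.
move=> a0 mE.
rewrite -[RHS]/(affine_image a b E).
apply: lebesgue_measure_unique => // _ [[c d]] _ <-.
rewrite /affine_image /= /mscale /= /pushforward.
have ap : 0 < `|a| by rewrite normr_gt0.
have [a1|a1] := ltP 0 a.
- rewrite (_ : _ @^-1` _ = `](c - b) / a, (d - b) / a]%classic); last first.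
    apply/seteqP; split => x /=; rewrite !in_itv/= /affine;
      by rewrite ltr_pdivrMr// ler_pdivlMr// ltrBlDr lerBrDr [x * a]mulrC.
  rewrite !lebesgue_measure_itv/= !lte_fin ltr_pM2r ?invr_gt0// ltrD2r.
  case: ifP => _; last by rewrite mule0.
  by rewrite -!EFinD -EFinM gtr0_norm// -mulrBl mulrCA divff ?mulr1//; congr EFin; ring.
- have {}a1 : a < 0 by rewrite lt_neqAle a0.
  (* For negative [a] the map reverses the order, so the half-open end of the interval changes
     sides. *)
  rewrite (_ : _ @^-1` _ = `[(d - b) / a, (c - b) / a[%classic); last first.
    apply/seteqP; split => x /=; rewrite !in_itv/= /affine => /andP[];
      rewrite ltr_ndivlMr// ler_ndivrMr// ltrBlDr lerBrDr [x * a]mulrC => -> ->//.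
  rewrite !lebesgue_measure_itv/= !lte_fin ltr_nM2r ?invr_lt0// ltrD2r.
  case: ifP => _; last by rewrite mule0.
  rewrite -!EFinD -EFinM ltr0_norm//; congr EFin.
  by rewrite -mulrBl; field.
Qed.

Local Open Scope ereal_scope.

Lemma ge0_integral_affine a b (f : R -> \bar R) : a != 0%R ->
  measurable_fun [set: measurableTypeR R] f -> (forall x, 0 <= f x) ->
  \int[mu]_x f (a * x + b)%R = `|a|^-1%:E * \int[mu]_x f x.
Proof.
move=> a0 mf f0.
rewrite [in RHS](eq_measure_integral (affine_image a b)); last first.
  by move=> E mE _; exact: lebesgue_measure_affine.
rewrite ge0_integral_mscale//= ge0_integral_pushforward//; last exact: measurable_affine.
by rewrite preimage_setT muleA -EFinM mulVf ?mul1e// normr_eq0.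
Qed.

End affine_substitution.

(** * Fubini, translations and linear substitutions in [R^n] *)

Section borel_lebesgue_theory.
Context {R : realType}.
Local Open Scope ereal_scope.
Implicit Types n : nat.

Lemma measurable_cV_entry n d (T : measurableType d) (f : T -> 'cV[R]_n) :
  (forall i, measurable_fun setT (fun x => f x i ord0 : R)) -> measurable_fun setT f.
Proof. by move=> mf; exact: measurable_fun_cVP. Qed.

Lemma measurable_fun_sumr d (T : measurableType d) (I : Type) (s : seq I)
    (f : I -> T -> R) : (forall i, measurable_fun setT (f i)) ->
  measurable_fun setT (fun x => \sum_(i <- s) f i x)%R.
Proof.
move=> mf; elim: s => [|i s ih].
  by under eq_fun do rewrite big_nil; exact: measurable_cst.
by under eq_fun do rewrite big_cons; exact: measurable_funD.
Qed.

Lemma measurable_mulmx m n (M : 'M[R]_(m, n)) :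
  measurable_fun setT (fun v : 'cV[R]_n => M *m v).
Proof.
apply: measurable_cV_entry => i; under eq_fun do rewrite mxE.
apply: measurable_fun_sumr => j; apply: measurable_funM => //.
exact: (measurable_cV_coord (R := R) j).
Qed.

Lemma measurable_cV_add n (w : 'cV[R]_n) :
  measurable_fun setT (fun v : 'cV[R]_n => (v + w)%R).
Proof.
apply: measurable_cV_entry => i; under eq_fun do rewrite mxE.
by apply: measurable_funD => //; exact: (measurable_cV_coord (R := R) i).
Qed.

Section cons.
Variables (n : nat) (f : 'cV[R]_n.+1 -> \bar R).
Hypothesis mf : measurable_fun setT f.
Hypothesis f0 : forall v, 0 <= f v.

Let mfc : measurable_fun setT (f \o @cV_cons R n).
Proof. by apply: measurableT_comp => //; exact: measurable_cV_cons. Qed.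

Let fc0 p : 0 <= (f \o @cV_cons R n) p. Proof. exact: f0. Qed.

Lemma integral_cons_prod : \int[borel_lebesgue R n.+1]_v f v =
  \int[(@lebesgue_measure R \x borel_lebesgue R n)]_p f (cV_cons p).
Proof.
rewrite -[RHS]/(\int[_]_(p in (@cV_cons R n) @^-1` setT) (f \o @cV_cons R n) p).
by rewrite -ge0_integral_pushforward//; exact: measurable_cV_cons.
Qed.

(** Both orders of integration are needed: with the first coordinate outside, lower shears become
    translations; with it inside ([integral_cons2]), upper triangular blocks become affine maps of
    the line. *)
Lemma integral_cons1 : \int[borel_lebesgue R n.+1]_v f v =
  \int[@lebesgue_measure R]_x \int[borel_lebesgue R n]_w f (cV_cons (x, w)).
Proof. by rewrite integral_cons_prod (fubini_tonelli1 (f \o @cV_cons R n)). Qed.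

Lemma integral_cons2 : \int[borel_lebesgue R n.+1]_v f v =
  \int[borel_lebesgue R n]_w \int[@lebesgue_measure R]_x f (cV_cons (x, w)).
Proof. by rewrite integral_cons_prod (fubini_tonelli2 (f \o @cV_cons R n)). Qed.

Lemma measurable_cons1 w : measurable_fun setT (fun x => f (cV_cons (x, w))).
Proof. by apply: (measurableT_comp mfc); exact: pair2_measurable. Qed.

Lemma measurable_cons2 x : measurable_fun setT (fun w => f (cV_cons (x, w))).
Proof. by apply: (measurableT_comp mfc); exact: pair1_measurable. Qed.

End cons.

Lemma cV_consD n (x y : R) (v w : 'cV[R]_n) :
  (cV_cons (x, v) + cV_cons (y, w) = cV_cons (x + y, v + w)%R)%R.
Proof. by apply/colP => i; rewrite !mxE; case: unlift => [j|]//=; rewrite mxE. Qed.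

Lemma cV_uncons_eta n (v : 'cV[R]_n.+1) : v = cV_cons (cV_uncons v).
Proof.
apply/colP => i; rewrite mxE /=; case: unliftP => [j ->|->//].
by rewrite mxE.
Qed.

Lemma cV_consE n (x : R) (v : 'cV[R]_n) :
  cV_cons (x, v) = col_mx x%:M v :> 'M[R]_(1 + n, 1).
Proof.
apply/colP => i; rewrite !mxE; case: splitP => j ij /=.
  by rewrite (_ : i = ord0) ?unlift_none ?ord1 ?mxE//=; apply/val_inj; rewrite /= ij ord1.
rewrite (_ : i = lift ord0 j) ?liftK//; apply/val_inj => /=.
by rewrite ij.
Qed.

(** Induction on the dimension: Fubini separates the first coordinate, where the affine substitution
    with slope 1 applies. *)
Lemma integral_borel_lebesgue_translate n (w : 'cV[R]_n) (f : 'cV[R]_n -> \bar R) :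
  measurable_fun setT f -> (forall v, 0 <= f v) ->
  \int[borel_lebesgue R n]_v f (v + w)%R = \int[borel_lebesgue R n]_v f v.
Proof.
elim: n w f => [|n ih] w f mf f0.
  by apply: eq_integral => v _; rewrite [v]flatmx0 [w]flatmx0 addr0.
have mfw : measurable_fun setT (fun v : 'cV[R]_n.+1 => f (v + w)%R).
  by apply: (measurableT_comp mf); exact: measurable_cV_add.
rewrite (integral_cons1 mfw)// (cV_uncons_eta w).
transitivity (\int[@lebesgue_measure R]_x \int[borel_lebesgue R n]_v
    f (cV_cons ((x + (cV_uncons w).1)%R, v))).
  apply: eq_integral => x _; under eq_integral do rewrite cV_consD.
  by rewrite (ih _ (fun v => f (cV_cons (_, v))))//; exact: measurable_cons2.
have := @ge0_integral_affine R 1 (cV_uncons w).1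
  (fun x => \int[borel_lebesgue R n]_v f (cV_cons (x, v))).
under eq_integral do rewrite mul1r.
move=> ->.
- by rewrite normr1 invr1 mul1e -integral_cons1.
- exact: oner_neq0.
- apply: (@measurable_fun_fubini_tonelli_F _ _ _ _ _ _ (f \o @cV_cons R n)).
    by apply: measurableT_comp => //; exact: measurable_cV_cons.
  by move=> *; exact: f0.
- by move=> x; exact: integral_ge0.
Qed.

(** The change of variables formula as a property of the matrix, so that it can be proved for
    elementary factors and multiplied. *)
Definition mulmx_scales n (M : 'M[R]_n) := forall f : 'cV[R]_n -> \bar R,
  measurable_fun setT f -> (forall v, 0 <= f v) ->
  \int[borel_lebesgue R n]_v f (M *m v) =
  (`|\det M|^-1)%:E * \int[borel_lebesgue R n]_v f v.

Lemma mulmx_scalesM n (M N : 'M[R]_n) :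
  mulmx_scales M -> mulmx_scales N -> mulmx_scales (M *m N).
Proof.
move=> hM hN f mf f0; under eq_integral do rewrite -mulmxA.
rewrite (hN (fun v : 'cV[R]_n => f (M *m v)))//; last first.
  by apply: (measurableT_comp mf); exact: measurable_mulmx.
by rewrite hM// muleA -EFinM det_mulmx normrM invfM mulrC.
Qed.

(** For fixed remaining coordinates [w], the first coordinate undergoes [x -> a x + b w], which
    costs the factor [1/|a|]; then [D] acts on [w] alone. *)
Lemma mulmx_scales_ublock n (a : R) (b : 'rV[R]_n) (D : 'M[R]_n) : a != 0%R ->
  mulmx_scales D -> mulmx_scales (block_mx a%:M b 0%R D : 'M[R]_(1 + n)).
Proof.
move=> a0 hD f mf f0.
set M := block_mx _ _ _ _.
have mfM : measurable_fun setT (fun v : 'cV[R]_n.+1 => f (M *m v)).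
  by apply: (measurableT_comp mf); exact: measurable_mulmx.
rewrite (integral_cons2 mfM)//.
transitivity (\int[borel_lebesgue R n]_w ((`|a|^-1)%:E *
    \int[@lebesgue_measure R]_x f (cV_cons (x, D *m w)))).
  apply: eq_integral => w _.
  rewrite -(ge0_integral_affine ((b *m w) ord0 ord0) a0 (measurable_cons1 mf _))//.
  apply: eq_integral => x _; congr f.
  rewrite !cV_consE mul_block_col mul0mx add0r; congr col_mx.
  by apply/rowP => i; rewrite ord1 mul_scalar_mx !mxE eqxx !mulr1n.
have mG : measurable_fun setT (fun w => \int[@lebesgue_measure R]_x f (cV_cons (x, w))).
  apply: (@measurable_fun_fubini_tonelli_G _ _ _ _ _ _ (f \o @cV_cons R n)).
    by apply: measurableT_comp => //; exact: measurable_cV_cons.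
  by move=> *; exact: f0.
rewrite ge0_integralZl//.
- rewrite (hD (fun w => \int[@lebesgue_measure R]_x f (cV_cons (x, w))))//; last first.
    by move=> v; exact: integral_ge0.
  by rewrite -integral_cons2// muleA -EFinM det_ublock det_scalar1 normrM invfM.
- by apply: (measurableT_comp mG); exact: measurable_mulmx.
- by move=> w _; exact: integral_ge0.
Qed.

(** For a fixed first coordinate [x], the shear only translates the other coordinates by [x c]. *)
Lemma mulmx_scales_lblock n (c : 'cV[R]_n) :
  mulmx_scales (block_mx 1%:M 0 c 1%:M : 'M[R]_(1 + n)).
Proof.
move=> f mf f0.
set M := block_mx _ _ _ _.
have mfM : measurable_fun setT (fun v : 'cV[R]_n.+1 => f (M *m v)).
  by apply: (measurableT_comp mf); exact: measurable_mulmx.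
rewrite (integral_cons1 mfM)// (integral_cons1 mf)//.
rewrite det_lblock !det1 mulr1 normr1 invr1 mul1e.
apply: eq_integral => x _.
rewrite -(integral_borel_lebesgue_translate (x *: c)%R (measurable_cons2 mf _))//.
apply: eq_integral => w _; congr f.
by rewrite !cV_consE mul_block_col !mul1mx mul0mx addr0 mul_mx_scalar addrC.
Qed.

Lemma mulmx_scales1 n : mulmx_scales (1%:M : 'M[R]_n).
Proof.
move=> f _ _; rewrite det1 normr1 invr1 mul1e.
by under eq_integral do rewrite mul1mx.
Qed.

(** One elimination step: a lower shear clears the column under the pivot [a] and leaves the Schur
    complement in place of [D]. *)
Lemma block_mx_pivotE n (a : R) (b : 'rV[R]_n) (c : 'cV[R]_n) (D : 'M[R]_n) :
  a != 0%R -> block_mx a%:M b c D = block_mx 1%:M 0 (a^-1 *: c)%R 1%:M *m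
    block_mx a%:M b 0%R (D - a^-1 *: (c *m b))%R :> 'M[R]_(1 + n).
Proof.
move=> a0; rewrite mulmx_block !mul1mx !mul0mx !addr0 mul_mx_scalar scalerA mulfV//.
by rewrite scale1r -scalemxAl addrC subrK.
Qed.

(* Gaussian elimination on the first column. If the corner entry vanishes, a
   shear first moves a nonzero entry of that column into the corner. *)
Lemma mulmx_scales_unit n (M : 'M[R]_n) : M \in unitmx -> mulmx_scales M.
Proof.
elim: n M => [|n ih] M uM.
  rewrite (_ : M = 1%:M); first exact: mulmx_scales1.
  by rewrite [LHS]flatmx0 [RHS]flatmx0.
have pivot (a : R) (b : 'rV[R]_n) (c : 'cV[R]_n) (D : 'M[R]_n) : a != 0%R ->
    (block_mx a%:M b c D : 'M[R]_(1 + n)) \in unitmx ->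
    mulmx_scales (block_mx a%:M b c D : 'M[R]_(1 + n)).
  move=> a0; rewrite block_mx_pivotE// unitmx_mul => /andP[_ u].
  apply: mulmx_scalesM; first exact: mulmx_scales_lblock.
  apply: mulmx_scales_ublock => //; apply: ih; move: u.
  by rewrite !unitmxE det_ublock unitrM => /andP[].
move: uM; change 'M[R]_(1 + n) in M.
rewrite -[M]submxK (mx11_scalar (ulsubmx M)).
set a := (ulsubmx M) _ _; set b := ursubmx M; set c := dlsubmx M; set D := drsubmx M.
have [a0|a0] := eqVneq a 0%R; last exact: pivot.
move=> u.
have [i ci] : exists i, c i ord0 != 0%R.
  apply/not_existsP => h.
  have c0 : c = 0%R.
    by apply/colP => i; rewrite [RHS]mxE; apply: contrapT => /eqP; exact: h.
  move: u; rewrite a0 c0 unitmxE.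
  by rewrite (@det_ublock _ 1 n) det_scalar1 mul0r unitr0.
pose e : 'rV[R]_n := delta_mx ord0 i.
have se : mulmx_scales (block_mx 1%:M (- e) 0 1%:M : 'M[R]_(1 + n)).
  by apply: mulmx_scales_ublock; [exact: oner_neq0 | exact: mulmx_scales1].
have E : block_mx a%:M b c D = block_mx 1%:M (- e)%R 0 1%:M *m
    block_mx (c i ord0)%:M (b + e *m D)%R c D.
  rewrite mulmx_block !mul1mx !mul0mx !add0r !mulNmx addrK; congr block_mx.
  apply/rowP => j; rewrite !ord1 !mxE eqxx !mulr1n (bigD1 i)//= big1 ?addr0.
    by rewrite !mxE !eqxx mul1r a0 subrr.
  by move=> k ki; rewrite mxE eqxx /= (negbTE ki) mul0r.
rewrite E; apply: mulmx_scalesM => //.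
apply: pivot => //.
by move: u; rewrite E unitmx_mul => /andP[].
Qed.

Lemma integral_borel_lebesgue_mulmx n (M : 'M[R]_n) (f : 'cV[R]_n -> \bar R) :
  M \in unitmx -> measurable_fun setT f -> (forall v, 0 <= f v) ->
  \int[borel_lebesgue R n]_v f (M *m v) =
  (`|\det M|^-1)%:E * \int[borel_lebesgue R n]_v f v.
Proof. by move=> uM; exact: mulmx_scales_unit. Qed.

Lemma borel_lebesgue_translate n (w : 'cV[R]_n) (E : set 'cV[R]_n) :
  measurable E -> borel_lebesgue R n [set v | E (v + w)%R] = borel_lebesgue R n E.
Proof.
move=> mE; rewrite -[in RHS](setIT E) -integral_indic//.
rewrite -(integral_borel_lebesgue_translate w)//; last first.
  exact/measurable_EFinP/measurable_indic.
rewrite integral_indic ?setIT// -[X in measurable X]setTI.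
exact: measurable_cV_add.
Qed.

Lemma borel_lebesgue_mulmx n (M : 'M[R]_n) (E : set 'cV[R]_n) : M \in unitmx ->
  measurable E -> borel_lebesgue R n [set v | E (M *m v)] =
  (`|\det M|^-1)%:E * borel_lebesgue R n E.
Proof.
move=> uM mE; rewrite -[in RHS](setIT E) -integral_indic//.
rewrite -(integral_borel_lebesgue_mulmx uM)//; last first.
  exact/measurable_EFinP/measurable_indic.
rewrite integral_indic ?setIT// -[X in measurable X]setTI.
exact: measurable_mulmx.
Qed.

End borel_lebesgue_theory.

(** * Homogeneity and measurability of the Euclidean norm *)

Section euclidean_norm.
Context {R : realType}.
Implicit Types n : nat.

Lemma enorm_ge0 n (v : 'cV[R]_n) : 0 <= enorm v.
Proof. exact: sqrtr_ge0. Qed.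

Lemma sqr_enorm n (v : 'cV[R]_n) : enorm v ^+ 2 = \sum_i v i ord0 ^+ 2.
Proof. by rewrite sqr_sqrtr// sumr_ge0// => i _; exact: sqr_ge0. Qed.

Lemma enormZ n (a : R) (v : 'cV[R]_n) : enorm (a *: v) = `|a| * enorm v.
Proof.
rewrite /enorm -sqrtr_sqr -sqrtrM ?sqr_ge0//; congr Num.sqrt.
by rewrite mulr_sumr; apply: eq_bigr => i _; rewrite mxE exprMn.
Qed.

Lemma enormN n (v : 'cV[R]_n) : enorm (- v) = enorm v.
Proof. by rewrite -scaleN1r enormZ normrN1 mul1r. Qed.

Lemma measurable_enorm n : measurable_fun setT (@enorm R n).
Proof.
apply: (@measurableT_comp _ _ _ _ _ _ (@Num.sqrt R)).
  by apply: continuous_measurable_fun; exact: sqrt_continuous.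
apply: measurable_fun_sumr => i; apply: measurable_funX.
exact: (measurable_cV_coord (R := R) i).
Qed.

Lemma measurable_enorm_le n (r : R) : measurable [set v : 'cV[R]_n | enorm v <= r].
Proof.
rewrite -[X in measurable X]setTI.
rewrite (_ : [set v | _] = (@enorm R n) @^-1` `]-oo, r]).
  by apply: measurable_enorm => //; exact: measurable_itv.
by apply/seteqP; split => v /=; rewrite in_itv.
Qed.

End euclidean_norm.

(** * Volume of Euclidean balls through the Gaussian integral *)

Section ball_volume.
Context {R : realType}.
Local Open Scope ereal_scope.
Implicit Types n : nat.

(** The Gaussian is a product of one-dimensional Gaussians, each of integral [sqrt pi]. In dimension
    0 the measure is the Dirac mass and the integral is 1. *)
Lemma integral_gauss_cV n :
  \int[borel_lebesgue R n]_v (expR (- enorm v ^+ 2))%:E = (Num.sqrt pi ^+ n)%:E.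
Proof.
elim: n => [|n ih].
  rewrite expr0 /= integral_dirac//=; last first.
    apply/measurable_EFinP; apply: measurableT_comp => //; apply: measurable_funN.
    by apply: measurable_funX; exact: measurable_enorm.
  rewrite diracE mem_set// mul1e /enorm big_ord0 sqrtr0 expr0n/=.
  by rewrite oppr0 expR0.
have mg k : measurable_fun setT (fun v : 'cV[R]_k => (expR (- enorm v ^+ 2))%:E).
  apply/measurable_EFinP; apply: measurableT_comp => //; apply: measurable_funN.
  by apply: measurable_funX; exact: measurable_enorm.
have g0 k (v : 'cV[R]_k) : 0 <= (expR (- enorm v ^+ 2))%:E.
  by rewrite lee_fin expR_ge0.
rewrite (integral_cons1 (mg _))//.
transitivity (\int[@lebesgue_measure R]_x ((Num.sqrt pi ^+ n)%:E * (gauss_fun x)%:E)).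
  apply: eq_integral => x _; rewrite muleC -ih -ge0_integralZl//; last 2 first.
  - exact: mg.
  - by rewrite lee_fin gauss_fun_ge0.
  apply: eq_integral => w _.
  rewrite -EFinM /gauss_fun -expRD -opprD; congr (expR (- _))%:E.
  rewrite !sqr_enorm big_ord_recl mxE unlift_none; congr (_ + _)%R.
  by apply: eq_bigr => i _; rewrite mxE liftK.
rewrite ge0_integralZl//.
- by rewrite integralT_gauss -EFinM exprSr.
- by apply/measurable_EFinP; exact: measurable_gauss_fun.
- by move=> x _; rewrite lee_fin gauss_fun_ge0.
Qed.

(** The dilation by [1/r] carries the ball to the unit ball and has determinant [r^-n]. *)
Lemma borel_lebesgue_ball_scale n (r : R) : (0 < r)%R ->
  borel_lebesgue R n [set v | enorm v <= r]%R =
  (r ^+ n)%:E * borel_lebesgue R n [set v | enorm v <= 1]%R.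
Proof.
move=> r0.
have uM : r^-1%:M \in @unitmx R n.
  by rewrite unitmxE det_scalar unitrX// unitfE invr_eq0 gt_eqF.
rewrite (_ : [set v | enorm v <= r]%R = [set v | [set v | enorm v <= 1]%R (r^-1%:M *m v)]).
  rewrite borel_lebesgue_mulmx//; last exact: measurable_enorm_le.
  by rewrite det_scalar normrX gtr0_norm ?invr_gt0// exprVn invrK.
apply/seteqP; split => v /=; rewrite mul_scalar_mx enormZ gtr0_norm ?invr_gt0//;
  by rewrite ler_pdivrMl// mulr1.
Qed.

(* Layer-cake: both sides are the integral of [expR (- t)] over the region
   [enorm v ^+ 2 <= t]. *)
Lemma integral_gauss_layer n : (0 < n)%N ->
  \int[borel_lebesgue R n]_v (expR (- enorm v ^+ 2))%:E =
  borel_lebesgue R n [set v | enorm v <= 1]%R *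
  \int[@lebesgue_measure R]_(t in `]0%R, +oo[) (t `^ (n%:R / 2) * expR (- t))%:E.
Proof.
move=> n0.
(* This equals [expR (- t)] on the region and 0 off it ([hE]). Written with the shifted exponential
   density, of total mass 1, it integrates in [t] to the Gaussian at once. *)
pose h (p : 'cV[R]_n * measurableTypeR R) : \bar R :=
  (expR (- enorm p.1 ^+ 2) * exponential_pdf 1 (p.2 - enorm p.1 ^+ 2))%:E.
have men : measurable_fun setT (fun p : 'cV[R]_n * measurableTypeR R => enorm p.1 ^+ 2)%R.
  by apply: measurable_funX; apply: measurableT_comp => //; exact: measurable_enorm.
have mh : measurable_fun setT h.
  apply/measurable_EFinP; apply: measurable_funM.
    by apply: measurableT_comp => //; exact: measurable_funN.
  apply: measurableT_comp; first exact: measurable_exponential_pdf.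
  exact: measurable_funB.
have h0 p : 0 <= h p.
  by rewrite lee_fin mulr_ge0 ?expR_ge0 ?exponential_pdf_ge0.
have hE v t : h (v, t) = (expR (- t))%:E * (\1_[set v | enorm v ^+ 2 <= t]%R v)%:E.
  rewrite /h /= indicE -EFinM; congr EFin.
  have [vt|vt] := leP (enorm v ^+ 2)%R t.
    rewrite mem_set// mulr1 exponential_pdfE ?subr_ge0// mul1r mulN1r -expRD.
    by rewrite opprB addKr.
  rewrite memNset ?mulr0//=; last by apply/negP; rewrite -ltNge.
  by rewrite lt0_exponential_pdf ?mulr0// subr_lt0.
transitivity (\int[borel_lebesgue R n]_v \int[@lebesgue_measure R]_t h (v, t)).
  apply: eq_integral => v _; rewrite /h/=.
  under eq_integral do rewrite EFinM.
  have mp : measurable_fun [set: measurableTypeR R]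
      (fun x => (exponential_pdf 1 x)%:E : \bar R).
    by apply/measurable_EFinP; exact: measurable_exponential_pdf.
  have p0 x : 0 <= (exponential_pdf (1 : R) x)%:E by rewrite lee_fin exponential_pdf_ge0.
  rewrite ge0_integralZl//; last first.
    apply/measurable_EFinP; apply: measurableT_comp; last exact: measurable_funB.
    exact: measurable_exponential_pdf.
  rewrite (_ : \int[_]_x _ = 1) ?mule1//.
  have := ge0_integral_affine (- enorm v ^+ 2) (oner_neq0 R) mp p0.
  rewrite normr1 invr1 mul1e integral_exponential_pdf// => <-.
  by apply: eq_integral => x _; rewrite mul1r.
rewrite (fubini_tonelli h)//.
have mball t : measurable [set v : 'cV[R]_n | (enorm v ^+ 2 <= t)%R].
  rewrite -[X in measurable X]setTI.
  rewrite (_ : [set v | _] = (fun v => @enorm R n v ^+ 2)%R @^-1` `]-oo, t]).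
    by have m2 := measurable_funX 2 (@measurable_enorm R n); apply: m2.
  by apply/seteqP; split => v /=; rewrite in_itv.
pose F t := (expR (- t))%:E * borel_lebesgue R n [set v | enorm v ^+ 2 <= t]%R.
have FE t : \int[borel_lebesgue R n]_v h (v, t) = F t.
  under eq_integral do rewrite hE.
  rewrite ge0_integralZl//; last first.
    by apply/measurable_EFinP; exact: measurable_indic.
  by rewrite integral_indic// setIT.
under eq_integral do rewrite FE.
have mF : measurable_fun setT F.
  rewrite -(_ : fubini_G (borel_lebesgue R n) h = F); last by apply/funext => t; exact: FE.
  exact: measurable_fun_fubini_tonelli_G.
have F0 t : 0 <= F t by rewrite mule_ge0// lee_fin expR_ge0.
have Fneg t : (t < 0)%R -> F t = 0.
  move=> t0; rewrite /F (_ : [set v | _] = set0) ?measure0 ?mule0//.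
  apply/seteqP; split => v //= /le_lt_trans /(_ t0).
  by rewrite ltNge sqr_ge0.
transitivity (\int[@lebesgue_measure R]_(t in `[0%R, +oo[) F t).
  rewrite [RHS]integral_mkcond; apply: eq_integral => t _; rewrite patchE.
  case: ifPn => //; rewrite notin_setE/= in_itv/= andbT => /negP; rewrite -ltNge.
  exact: Fneg.
(* The endpoint 0 is null; dropping it gives the domain of integration of [Gamma] and makes every
   radius [sqrt t] positive. *)
rewrite -integral_itv_obnd_cbnd; last exact: measurable_funTS.
rewrite -ge0_integralZl//.
- apply: eq_integral => t /[!inE]/= /[!in_itv]/= /[!andbT] t0.
  rewrite /F muleC EFinM muleA; congr (_ * _).
  rewrite muleC [(n%:R / 2)%R]mulrC powRrM powR12_sqrt ?ltW// powR_mulrn ?sqrtr_ge0//.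
  rewrite -borel_lebesgue_ball_scale ?sqrtr_gt0//; congr (borel_lebesgue R n _).
  apply/seteqP; split => v /=;
    by rewrite -[X in (X <= Num.sqrt t)%R](ger0_norm (enorm_ge0 v)) -sqrtr_sqr ler_sqrt// ltW.
- apply/measurable_EFinP; apply: measurable_funTS; apply: measurable_funM.
    exact: measurable_powR.
  by apply: measurableT_comp => //; exact: measurable_funN.
- by move=> t _; rewrite lee_fin mulr_ge0 ?powR_ge0 ?expR_ge0.
Qed.

(** The two evaluations of the Gaussian integral give [sqrt(pi)^n = om * Gamma(n/2 + 1)], which is
    solved for the volume [om] of the unit ball. *)
Lemma borel_lebesgue_ball n (r : R) : (0 < n)%N -> (0 < r)%R ->
  borel_lebesgue R n [set v | enorm v <= r]%R =
  (pi `^ (n%:R / 2) / Gamma (n%:R / 2 + 1) * r ^+ n)%:E.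
Proof.
move=> n0 r0; rewrite borel_lebesgue_ball_scale//.
set om := borel_lebesgue R n _.
have om0 : 0 <= om by exact: measure_ge0.
have := integral_gauss_layer n0; rewrite integral_gauss_cV -/om.
rewrite /Gamma /Rintegral addrK.
set G := \int[_]_(t in _) _.
have G0 : 0 <= G.
  by apply: integral_ge0 => t _; rewrite lee_fin mulr_ge0 ?powR_ge0 ?expR_ge0.
have p0 : (0 < Num.sqrt pi ^+ n :> R)%R by rewrite exprn_gt0// sqrtr_gt0 pi_gt0.
rewrite [(n%:R / 2)%R]mulrC powRrM powR12_sqrt ?pi_ge0// powR_mulrn ?sqrtr_ge0//.
move: p0; set c := (Num.sqrt pi ^+ n)%R => c0.
(* Neither factor can be infinite, since the product would be infinite or 0 while [c] is finite and
   positive. In particular the real number [Gamma] is not the default value of a divergent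
   integral. *)
case: om om0 => [w| |]// om0; case: G G0 => [g| |]// G0 /=.
- rewrite -EFinM; case=> E; rewrite -EFinM; congr EFin; rewrite mulrC; congr (_ * _)%R.
  rewrite E mulfK//; apply/eqP => g0; move: c0; by rewrite E g0 mulr0 ltxx.
- move=> E; have [w0|w0] := eqVneq w 0%R.
    by move: E c0; rewrite w0 mul0e; case=> ->; rewrite ltxx.
  by move: E; rewrite muleC mulyr gtr0_sg ?mul1e// lt_neqAle eq_sym w0.
- move=> E; have [w0|w0] := eqVneq g 0%R.
    by move: E c0; rewrite w0 mule0; case=> ->; rewrite ltxx.
  by move: E; rewrite mulyr gtr0_sg ?mul1e// lt_neqAle eq_sym w0.
Qed.

End ball_volume.

(** * Integrals of nonnegative functions: monotonicity and sums of indicators *)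

Section nonmeasurable_monotone.
Context d (T : measurableType d) (R : realType).
Variables (mu : {measure set T -> \bar R}) (D : set T).
Local Open Scope ereal_scope.

Import HBNNSimple.

(* Unlike [ge0_le_integral], no measurability is required: the integral of a
   nonnegative function is the supremum of the integrals of the simple functions
   below it. *)
Lemma ge0_le_integral_nonmeasurable (f g : T -> \bar R) :
  (forall x, D x -> 0 <= f x) -> (forall x, D x -> f x <= g x) ->
  \int[mu]_(x in D) f x <= \int[mu]_(x in D) g x.
Proof.
move=> f0 fg; rewrite !(integral_mkcond D).
have f0' x : 0 <= (f \_ D) x by exact: erestrict_ge0.
have fg' x : (f \_ D) x <= (g \_ D) x by exact: lee_restrict.
rewrite !ge0_integralTE//; last by move=> x; exact: le_trans (fg' x).
apply: ereal_sup_le => _ [h hf <-].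
by exists h => // x; exact: le_trans (hf x) (fg' x).
Qed.

End nonmeasurable_monotone.

Lemma ge0_integral_sum_indic d (T : measurableType d) (R : realType)
    (mu : {measure set T -> \bar R}) (D : set T) (I : Type) (s : seq I)
    (c : R) (F : I -> set T) :
  measurable D -> 0 <= c -> (forall i, measurable (F i)) ->
  (\int[mu]_(x in D) \sum_(i <- s) (c * \1_(F i) x)%:E =
   \sum_(i <- s) c%:E * mu (F i `&` D))%E.
Proof.
move=> mD c0 mF; have mI i : measurable_fun D (EFin \o \1_(F i)).
  exact/measurable_EFinP/measurable_indic.
rewrite ge0_integral_sum//; last 2 first.
- by move=> i; apply/measurable_EFinP; apply: measurable_funM => //; exact: measurable_indic.
- by move=> i x _; rewrite lee_fin mulr_ge0.
apply: eq_bigr => i _; under eq_integral do rewrite EFinM.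
rewrite ge0_integralZl//; first by rewrite integral_indic.
exact: mI.
Qed.

(** * Mean and variance of a bounded function on a probability space *)

Section variance.
Context d (T : measurableType d) (R : realType).
Variables (nu : {measure set T -> \bar R}) (D : set T) (f : T -> R) (M : R).
Hypotheses (mD : measurable D) (nuD : nu D = 1%E).
Hypotheses (mf : measurable_fun D f) (fM : forall x, D x -> `|f x| <= M).

Lemma bounded_integrable_prob (g : T -> R) (K : R) : measurable_fun D g ->
  (forall x, D x -> `|g x| <= K) -> nu.-integrable D (EFin \o g).
Proof.
move=> mg gK; apply: measurable_bounded_integrable => //; first by rewrite nuD ltry.
by exists K; split; rewrite ?num_real// => y Ky x Dx; exact: le_trans (gK x Dx) (ltW Ky).
Qed.

Definition mean : R := \int[nu]_(x in D) f x.
Definition variance : R := \int[nu]_(x in D) (f x - mean) ^+ 2.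

Lemma variance_ge0 : 0 <= variance.
Proof. by apply: Rintegral_ge0 => x _; exact: sqr_ge0. Qed.

(** Bias-variance decomposition. The constant [V] carries the variance already collected from other
    coordinates, as the induction over the points requires. *)
Lemma integral_sqr_shift (V a : R) :
  (\int[nu]_(x in D) (V + (f x + a) ^+ 2)%:E = (V + variance + (mean + a) ^+ 2)%:E)%E.
Proof.
have inf : nu.-integrable D (EFin \o f) by exact: bounded_integrable_prob fM.
have icst c : nu.-integrable D (EFin \o cst c).
  by apply: (@bounded_integrable_prob _ `|c|) => //; exact: measurable_cst.
have isqr c : nu.-integrable D (EFin \o (fun x => (f x + c) ^+ 2)).
  apply: (@bounded_integrable_prob _ ((M + `|c|) ^+ 2)).
    by apply: measurable_funX; exact: measurable_funD.
  move=> x Dx; rewrite normrX lerXn2r ?nnegrE ?addr_ge0//.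
    exact: le_trans (fM Dx).
  by rewrite (le_trans (ler_normD _ _))// lerD2r fM.
have ilin c : nu.-integrable D (EFin \o (fun x => c * f x)).
  apply: (@bounded_integrable_prob _ (`|c| * M)).
    exact: measurable_funM.
  by move=> x Dx; rewrite normrM ler_wpM2l// fM.
have cstE c : \int[nu]_(_ in D) c = c by rewrite Rintegral_cst// nuD mulr1.
have tot : nu.-integrable D (EFin \o (fun x => V + (f x + a) ^+ 2)).
  by rewrite (_ : _ \o _ = (EFin \o cst V) \+ (EFin \o (fun x => (f x + a) ^+ 2)))//;
    exact: integrableD.
rewrite -[LHS]fineK; last exact: integrable_fin_num tot.
congr EFin; rewrite -/(Rintegral nu D _).
(* Expansion of the square around the mean [m]: the term [c2 * (f - m)] integrates to 0. *)
pose m := mean; pose c2 := 2 * (m + a).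
rewrite (@eq_Rintegral _ _ _ nu D
  (fun x => (f x + (- m)) ^+ 2 + (c2 * f x + (V + (m + a) ^+ 2 - c2 * m)))).
  rewrite RintegralD//; last first.
    by rewrite (_ : _ \o _ = (EFin \o (fun x => c2 * f x)) \+
      (EFin \o cst (V + (m + a) ^+ 2 - c2 * m)))//;
      exact: integrableD.
  rewrite RintegralD//; last exact: icst.
  rewrite (RintegralZl c2)// cstE -/mean -/m.
  rewrite /variance -/m; ring.
by move=> x _; rewrite /c2; ring.
Qed.

(** The mean minimizes the quadratic deviation, so the deviation from any constant [c] bounds the
    variance. *)
Lemma variance_le (c G : R) : (forall x, D x -> `|f x - c| <= G) -> variance <= G ^+ 2.
Proof.
move=> fG; rewrite -lee_fin.
apply: (@le_trans _ _ (\int[nu]_(x in D) (0 + (f x + (- c)) ^+ 2)%:E)%E).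
  by rewrite integral_sqr_shift add0r lee_fin lerDl sqr_ge0.
apply: (@le_trans _ _ (\int[nu]_(x in D) (cst (G ^+ 2)%:E x))%E).
  apply: ge0_le_integral_nonmeasurable => x Dx; rewrite lee_fin add0r ?sqr_ge0//.
  by rewrite -[_ ^+ 2]ger0_norm ?sqr_ge0// normrX lerXn2r ?nnegrE// ?(le_trans _ (fG _ Dx))// fG.
by rewrite integral_cst// nuD mule1.
Qed.

End variance.

(** * Independent points: the variances add up *)

Section iterated_variance.
Context d (T : measurableType d) (R : realType).

(** Induction on the number of points with [c] arbitrary: once the first point [x] is fixed, [f x]
    is absorbed into the constant, and the outer integral is of the form [integral_sqr_shift]. *)
Lemma iterated_integral_sqr (N : nat) (nu : 'I_N -> {measure set T -> \bar R})
    (D : 'I_N -> set T) (f : T -> R) (M c : R) :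
  (forall j, measurable (D j)) -> (forall j, nu j (D j) = 1%E) ->
  (forall j, measurable_fun (D j) f) -> (forall j x, D j x -> `|f x| <= M) ->
  iterated_integral (fun j => nu j) D
    (fun s => ((\sum_(j < N) f (tnth s j) - c) ^+ 2)%:E) =
  (\sum_j variance (nu j) (D j) f + (\sum_j mean (nu j) (D j) f - c) ^+ 2)%:E.
Proof.
elim: N nu D c => [|N ih] nu D c mD nuD mf fM /=; first by rewrite !big_ord0 !add0r.
rewrite [in RHS]big_ord_recl [in X in (_ + X)%R]big_ord_recl.
set V := \sum_(i < N) _; set m := \sum_(i < N) _.
transitivity (\int[nu ord0]_(x in D ord0) (V + (f x + (m - c)) ^+ 2)%:E)%E.
  apply: eq_integral => x /[!inE] Dx.
  rewrite (_ : (fun s => _) = (fun s : N.-tuple T =>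
    ((\sum_(j < N) f (tnth s j) - (c - f x)) ^+ 2)%:E)); last first.
    apply/funext => s; rewrite big_ord_recl tnth0; congr (_ ^+ 2)%:E.
    rewrite (eq_bigr (fun j => f (tnth s j))); first by ring.
    by move=> j _; rewrite tnthS.
  rewrite ih//=; last by move=> j y; exact: fM.
  by rewrite -/V -/m; congr (_ + _ ^+ 2)%:E; ring.
rewrite (integral_sqr_shift (M := M))//; last exact: fM.
by congr EFin; ring.
Qed.

End iterated_variance.

(** * Cauchy-Schwarz and the triangle inequality *)

Section triangle_inequality.
Context {R : realType}.

Lemma enorm_eq0 n (v : 'cV[R]_n) : enorm v = 0 -> v = 0.
Proof.
move=> v0; have : \sum_i v i ord0 ^+ 2 == 0 by rewrite -sqr_enorm v0 expr0n.
rewrite psumr_eq0; last by move=> i _; exact: sqr_ge0.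
move=> /allP h; apply/colP => i; rewrite mxE; apply/eqP.
by rewrite -sqrf_eq0; apply: h; rewrite mem_index_enum.
Qed.

(** For nonzero vectors, expand the nonnegative sum of the squares of [u_i |v| - v_i |u|] and divide
    by [2 |u| |v|]. *)
Lemma cauchy_schwarz n (u v : 'cV[R]_n) :
  \sum_i u i ord0 * v i ord0 <= enorm u * enorm v.
Proof.
have [/enorm_eq0 ->|u0] := eqVneq (enorm u) 0.
  by rewrite big1 ?mulr_ge0 ?enorm_ge0// => i _; rewrite mxE mul0r.
have [/enorm_eq0 ->|v0] := eqVneq (enorm v) 0.
  by rewrite big1 ?mulr_ge0 ?enorm_ge0// => i _; rewrite mxE mulr0.
set a := enorm u; set b := enorm v.
have a0 : 0 < a by rewrite lt_neqAle eq_sym u0 enorm_ge0.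
have b0 : 0 < b by rewrite lt_neqAle eq_sym v0 enorm_ge0.
have : 0 <= \sum_i (u i ord0 * b - v i ord0 * a) ^+ 2.
  by apply: sumr_ge0 => i _; exact: sqr_ge0.
rewrite (eq_bigr (fun i => (b ^+ 2 * u i ord0 ^+ 2 + a ^+ 2 * v i ord0 ^+ 2)
   - 2 * a * b * (u i ord0 * v i ord0))); last by move=> i _; ring.
rewrite sumrB big_split/= -!mulr_sumr -!sqr_enorm -/a -/b subr_ge0.
rewrite (_ : _ + _ = 2 * a * b * (a * b)); last by ring.
by rewrite ler_pM2l// !mulr_gt0.
Qed.

Lemma enormD n (u v : 'cV[R]_n) : enorm (u + v) <= enorm u + enorm v.
Proof.
rewrite -ler_sqr ?nnegrE ?addr_ge0 ?enorm_ge0// sqr_enorm.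
rewrite (eq_bigr (fun i => u i ord0 ^+ 2 + 2 * (u i ord0 * v i ord0) + v i ord0 ^+ 2));
  last by move=> i _; rewrite mxE; ring.
rewrite 2!big_split/= -mulr_sumr -!sqr_enorm sqrrD lerD2r lerD2l -[leRHS]mulr_natl.
by rewrite ler_pM2l// cauchy_schwarz.
Qed.

Lemma enorm_le_dist n (u v : 'cV[R]_n) (e : R) : enorm (u - v) <= e ->
  enorm u <= enorm v + e.
Proof.
move=> uv; rewrite -{1}(subrK v u) addrC (le_trans (enormD _ _))// lerD2l//.
Qed.

Lemma coord_le_enorm n (v : 'cV[R]_n) i : `|v i ord0| <= enorm v.
Proof.
rewrite -sqrtr_sqr ler_wsqrtr// (bigD1 i)//= lerDl sumr_ge0// => j _.
exact: sqr_ge0.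
Qed.

End triangle_inequality.

(** * Measure of a set cut along translated tiles *)

Section tiling.
Context {R : realType} {d : nat}.
Implicit Types (E Om : set 'cV[R]_d).

Lemma fsume_finType (I : finType) (f : I -> \bar R) :
  (\sum_(i \in [set: I]) f i = \sum_i f i)%E.
Proof.
rewrite [RHS]fsbig_seq ?index_enum_uniq//; congr (\big[_/_]_(i \in _) _)%E.
by apply/seteqP; split => i //= _; rewrite mem_index_enum.
Qed.

Lemma measure_bigcup_finType disp (T : measurableType disp)
    (mu : {measure set T -> \bar R}) (I : finType) (F : I -> set T) :
  (forall i, measurable (F i)) -> trivIset setT F ->
  (mu (\bigcup_i F i) = \sum_i mu (F i))%E.
Proof.
move=> mF tF; rewrite measure_fin_bigcup//; first exact: fsume_finType.
exact: finite_finset.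
Qed.

(** The part of [E] inside the tile [Om + t i], moved back by [t i], keeps its measure; these parts
    partition [E]. *)
Lemma tile_sum (I : finType) (t : I -> 'cV[R]_d) Om E :
  measurable Om -> measurable E ->
  (forall w, E w -> exists i, Om (w - t i)) ->
  (forall i j w, Om (w - t i) -> Om (w - t j) -> i = j) ->
  (\sum_i borel_lebesgue R d (Om `&` [set y | E (y + t i)%R]) =
   borel_lebesgue R d E)%E.
Proof.
move=> mOm mE cov disj.
pose S i := [set w | Om (w - t i)] `&` E.
have mS i : measurable (S i).
  apply: measurableI => //; rewrite -[X in measurable X]setTI.
  exact: measurable_cV_add.
rewrite (eq_bigr (fun i => borel_lebesgue R d (S i))).
  rewrite -measure_bigcup_finType//.
    congr (borel_lebesgue R d _); apply/seteqP; split => [w [i _ []//]|w Ew].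
    by have [i Oi] := cov _ Ew; exists i.
  apply/trivIsetP => i j _ _ ij; apply/seteqP; split => // w [[Oi _] [Oj _]].
  by move: ij; rewrite (disj _ _ _ Oi Oj) eqxx.
move=> i _; rewrite -(borel_lebesgue_translate (t i) (mS i)).
by congr (borel_lebesgue R d _); apply/seteqP; split => v; rewrite /S/= addrK.
Qed.

End tiling.

(** * The unit cube *)

Section cube.
Context {R : realType}.

Definition cube n : set 'cV[R]_n := [set a | forall j, 0 <= a j ord0 < 1].
Arguments cube : clear implicits.

Lemma measurable_cube n : measurable (cube n).
Proof.
rewrite (_ : cube n = \bigcap_(j in [set: 'I_n]) [set a | 0 <= a j ord0 < 1]).
  apply: fin_bigcap_measurable => // j _.
  rewrite [X in measurable X](_ : _ = cV_coord j @^-1` `[0, 1[%classic).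
    by rewrite -[X in measurable X]setTI; exact: measurable_cV_coord.
  by apply/seteqP; split => v /=; rewrite in_itv.
by apply/seteqP; split => v /= h j; [move=> _; exact: h | exact: (h j)].
Qed.

Lemma borel_lebesgue_cube n : borel_lebesgue R n (cube n) = 1%E.
Proof.
elim: n => [|n ih].
  by rewrite /= diracE mem_set// => -[].
rewrite /= /cons_measure /pushforward.
rewrite (_ : _ @^-1` _ = `[0, 1[%classic `*` cube n).
  rewrite product_measure1E//; last exact: measurable_cube.
  by rewrite ih mule1 -[LHS]/(@lebesgue_measure R `[0, 1[%classic) lebesgue_measure_itv/=
    lte01 oppr0 adde0.
apply/seteqP; split => -[x v] /=.
  move=> h; split => [|j]; first by have := h ord0; rewrite mxE unlift_none in_itv.
  by have := h (lift ord0 j); rewrite mxE liftK.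
rewrite in_itv/= => -[x01 hv] i; rewrite mxE.
by case: unliftP => [j _|_] //=; exact: hv.
Qed.

End cube.
Arguments cube {R} n _.

(** * Borel sets in the completed Lebesgue space *)

Section Rn_theory.
Context {R : realType} {n : nat}.

Lemma measurable_Rn (E : set 'cV[R]_n) : measurable E ->
  measurable (E : set (Rn R n)).
Proof. by move=> mE; exact: caratheodory_measurable_mu_ext. Qed.

Lemma lebesgue_RnE (E : set 'cV[R]_n) : measurable E ->
  lebesgue_Rn E = borel_lebesgue R n E.
Proof. by move=> mE; exact: measurable_mu_extE. Qed.

End Rn_theory.

(** * Fundamental domain, covolume and finite boxes of lattice vectors *)

Section fundamental_domain.
Context {R : realType} {d : nat} (A : 'M[R]_d).
Hypothesis hA : A \in unitmx.

Lemma fund_domainE : fund_domain A = [set v | cube d (invmx A *m v)].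
Proof.
apply/seteqP; split => [_ [a a01 <-] j|v h]; first by rewrite mulKmx.
by exists (invmx A *m v) => //; rewrite mulKVmx.
Qed.

Lemma measurable_fund_domain : measurable (fund_domain A).
Proof.
rewrite fund_domainE -[X in measurable X]setTI.
by apply: measurable_mulmx => //; exact: measurable_cube.
Qed.

Lemma borel_lebesgue_fund_domain : borel_lebesgue R d (fund_domain A) = (`|\det A|)%:E.
Proof.
rewrite fund_domainE borel_lebesgue_mulmx ?unitmx_inv//; last exact: measurable_cube.
by rewrite borel_lebesgue_cube mule1 det_inv normfV invrK.
Qed.

(** The integer coordinates are forced to be the floors of the coordinates of [invmx A *m w]; the
    same floors give existence in [fund_domain_cover]. *)
Lemma fund_domain_uniq (w : 'cV[R]_d) (z z' : 'cV[int]_d) :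
  fund_domain A (w - A *m map_mx intr z) -> fund_domain A (w - A *m map_mx intr z') ->
  z = z'.
Proof.
have fl (u : 'cV[int]_d) : fund_domain A (w - A *m map_mx intr u) ->
    forall i, u i ord0 = Num.floor ((invmx A *m w) i ord0).
  rewrite fund_domainE /= mulmxBr mulKmx// => h i.
  have := h i; rewrite !mxE => /andP[h0 h1]; apply/esym/floor_def.
  by rewrite -subr_ge0 h0/= intrD -ltrBlDl.
by move=> /fl h /fl h'; apply/colP => i; rewrite h h'.
Qed.

Lemma fund_domain_cover (w : 'cV[R]_d) :
  exists z : 'cV[int]_d, fund_domain A (w - A *m map_mx intr z).
Proof.
exists (\col_i Num.floor ((invmx A *m w) i ord0)).
rewrite fund_domainE /= mulmxBr mulKmx// => i; rewrite !mxE.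
have /andP[h0 h1] := floor_itv ((invmx A *m w) i ord0).
move: h0 h1; rewrite !mxE intrD => h0 h1.
by rewrite subr_ge0 h0 ltrBlDl.
Qed.

(** A finite index type for integer vectors with coordinates between [-K] and [K], stored with an
    offset of [K]; lattice sums become finite sums over it. *)
Definition lattice_box (K : nat) := {ffun 'I_d -> 'I_(K.*2.+1)}.

Definition box_vec K (f : lattice_box K) : 'cV[int]_d := \col_i ((f i : nat)%:Z - K%:Z).

Definition lattice_vec K (f : lattice_box K) : 'cV[R]_d := A *m map_mx intr (box_vec f).

Lemma box_vec_inj K : injective (@box_vec K).
Proof.
move=> f g /colP fg; apply/ffunP => i; have := fg i; rewrite !mxE.
by move=> /addIr [] /val_inj.
Qed.

Lemma lattice_vec_inj K : injective (@lattice_vec K).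
Proof.
move=> f g /(can_inj (mulKmx hA)) /colP fg; apply: box_vec_inj; apply/colP => i.
by have := fg i; rewrite !mxE => /eqP; rewrite eqr_int => /eqP.
Qed.

Lemma box_vec_surj K (z : 'cV[int]_d) : (forall i, `|z i ord0| <= K%:Z) ->
  exists f : lattice_box K, box_vec f = z.
Proof.
move=> zK; exists [ffun i => inord (absz (z i ord0 + K%:Z))].
apply/colP => i; rewrite mxE ffunE.
have := zK i; rewrite ler_norml => /andP[z1 z2].
have z0 : 0 <= z i ord0 + K%:Z by rewrite -lerBlDr sub0r.
rewrite inordK; first by rewrite gez0_abs// addrK.
rewrite ltnS -lez_nat gez0_abs// -addnn PoszD lerD2r//.
Qed.

(** With [w = y + A z - x], the vector [z] is the image of [w] under the inverse of [A], plus a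
    difference of two vectors of the unit cube. *)
Lemma fund_domain_lattice_bound (rho : R) : exists K, forall x y (z : 'cV[int]_d),
  fund_domain A x -> fund_domain A y -> enorm (y + A *m map_mx intr z - x) <= rho ->
  exists f : lattice_box K, box_vec f = z.
Proof.
pose S := \sum_(i < d) \sum_(j < d) `|invmx A i j|.
have S0 : 0 <= S by apply: sumr_ge0 => i _; apply: sumr_ge0.
(* [S * |rho|] bounds the coordinates of the image of [w], and 1 bounds those of the difference in
   the cube. *)
exists (Num.trunc (1 + S * `|rho|)).+1 => x y z; rewrite !fund_domainE /= => hx hy h.
apply: box_vec_surj => i; rewrite -(ler_int R) intr_norm.
set w := _ - x in h.
have zE : (z i ord0)%:~R = (invmx A *m w) i ord0 + (invmx A *m x) i ord0
    - (invmx A *m y) i ord0.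
  by rewrite /w mulmxBr mulmxDr mulKmx// !mxE; ring.
have wb : `|(invmx A *m w) i ord0| <= S * `|rho|.
  rewrite mxE (le_trans (ler_norm_sum _ _ _))//.
  apply: (@le_trans _ _ (\sum_j `|invmx A i j| * `|rho|)).
    apply: ler_sum => j _; rewrite normrM ler_wpM2l//.
    exact: le_trans (coord_le_enorm _ _) (le_trans h (ler_norm _)).
  rewrite -mulr_suml ler_wpM2r// /S [leRHS](bigD1 i)//= lerDl.
  by apply: sumr_ge0 => k _; apply: sumr_ge0.
have /andP[x0 x1] := hx i; have /andP[y0 y1] := hy i.
have zb : `|(z i ord0)%:~R : R| <= 1 + S * `|rho|.
  move: wb; rewrite zE !ler_norml; set a := (_ *m w) i ord0.
  by move=> /andP[]; lra.
apply: (le_trans zb); apply: ltW; rewrite -pmulrn.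
have /andP[_ //] := @truncn_itv R _ (addr_ge0 ler01 (mulr_ge0 S0 (normr_ge0 rho))).
Qed.

(** Trades a cardinality for a finite sum of indicators. The box also shows that the counted set is
    finite, so [fset_set] does not fall back on the empty set. *)
Lemma ball_indicator_sum K (x y : 'cV[R]_d) (r : R) :
  (forall z : 'cV[int]_d, enorm (y + A *m map_mx intr z - x) <= r ->
    exists f : lattice_box K, box_vec f = z) ->
  ball_indicator A x r y =
  \sum_(f : lattice_box K) (enorm (y + lattice_vec f - x) <= r)%R%:R.
Proof.
move=> hK; rewrite /ball_indicator.
set S := [set v | _].
pose s := [seq lattice_vec f | f <- index_enum (lattice_box K)
  & enorm (y + lattice_vec f - x) <= r].
have Ss v : S v <-> v \in s.
  split.
    move=> [[z _ <-] h]; have [f fz] := hK _ h.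
    apply/mapP; exists f; last by rewrite /lattice_vec fz.
    by rewrite mem_filter mem_index_enum /lattice_vec fz h.
  move=> /mapP[f]; rewrite mem_filter => /andP[h _] ->; split => //.
  by exists (box_vec f).
have Sfin : finite_set S.
  by apply: sub_finite_set (finite_seq s) => v /Ss.
have -> : #|` fset_set S| = size s.
  apply: perm_size; apply: uniq_perm; first exact: fset_uniq.
    rewrite map_inj_uniq; last exact: lattice_vec_inj.
    by rewrite filter_uniq// index_enum_uniq.
  move=> v; rewrite in_fset_set//; apply/idP/idP.
    by move=> /set_mem /Ss.
  by move=> vs; apply/mem_set/Ss.
rewrite size_map size_filter -sum1_count natr_sum big_mkcond/=.
by apply: eq_bigr => f _; case: ifP.
Qed.

End fundamental_domain.

Arguments lattice_box d K : clear implicits.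

(** * Volume of annuli *)

Section annulus.
Context {R : realType}.

Definition annulus n (r1 r2 : R) : set 'cV[R]_n := [set w | r1 < enorm w <= r2].
Arguments annulus : clear implicits.

Lemma measurable_annulus n r1 r2 : measurable (annulus n r1 r2).
Proof.
rewrite (_ : annulus n r1 r2 = [set w | enorm w <= r2] `\` [set w | enorm w <= r1]).
  by apply: measurableD; exact: measurable_enorm_le.
apply/seteqP; split => w; rewrite /annulus/=.
  by move=> /andP[w1 ->]; split => //; apply/negP; rewrite -ltNge.
by move=> [-> /negP]; rewrite -ltNge => ->.
Qed.

(** The volume of the unit ball of [R^n]. *)
Definition ball_const n : R := pi `^ (n%:R / 2) / Gamma (n%:R / 2 + 1).

Lemma ball_const_ge0 n : 0 <= ball_const n.
Proof.
rewrite /ball_const divr_ge0 ?powR_ge0//; apply: Rintegral_ge0 => t _.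
by rewrite mulr_ge0 ?powR_ge0 ?expR_ge0.
Qed.

(** A null unit ball would make the Gaussian integral vanish in its layered form. *)
Lemma ball_const_gt0 n : (0 < n)%N -> 0 < ball_const n.
Proof.
move=> n0; rewrite lt_neqAle ball_const_ge0 andbT eq_sym; apply/eqP => b0.
have := @integral_gauss_layer R n n0; rewrite integral_gauss_cV borel_lebesgue_ball//.
rewrite -/(ball_const n) b0 mul0r mul0e; case=> /eqP; apply/negP.
by rewrite expf_neq0// sqrtr_eq0 -ltNge pi_gt0.
Qed.

Lemma borel_lebesgue_annulus_le n (r e : R) : (0 < n)%N -> 0 < r -> 0 <= e ->
  (borel_lebesgue R n (annulus n (r - e) (r + e)) <=
   (ball_const n * (n%:R * (2 * e)) * (r + e) ^+ n.-1)%:E)%E.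
Proof.
move=> n0 r0 e0; have re0 : 0 < r + e by rewrite ltr_pwDl.
(* For [r <= e] there is no inner ball: the whole outer ball is small enough, because
   [r + e <= 2 e]. Otherwise [(r + e)^n - (r - e)^n] factors as [2 e] times a sum of [n] terms, each
   at most [(r + e)^(n-1)]. *)
have [re|re] := leP r e.
  apply: (@le_trans _ _ (borel_lebesgue R n [set w | enorm w <= r + e]%R)).
    apply: le_measure; rewrite ?inE//; first exact: measurable_annulus.
      exact: measurable_enorm_le.
    by move=> w /andP[].
  rewrite borel_lebesgue_ball// lee_fin -/(ball_const n).
  have -> : (r + e) ^+ n = (r + e) * (r + e) ^+ n.-1 by rewrite -exprS prednK.
  rewrite [leLHS]mulrA ler_wpM2r ?(exprn_ge0 _ (ltW re0))// ler_wpM2l ?ball_const_ge0//.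
  apply: (@le_trans _ _ (1 * (2 * e))); first by lra.
  by rewrite ler_wpM2r// ?ler1n//; lra.
have rse : 0 < r - e by rewrite subr_gt0.
rewrite (_ : annulus n _ _ =
    [set w | enorm w <= r + e] `\` [set w | enorm w <= r - e]); last first.
  apply/seteqP; split => w; rewrite /annulus/=.
    by move=> /andP[w1 ->]; split => //; apply/negP; rewrite -ltNge.
  by move=> [-> /negP]; rewrite -ltNge => ->.
have fin : (borel_lebesgue R n [set w | enorm w <= r + e]%R < +oo)%E.
  by rewrite borel_lebesgue_ball// ltry.
have -> : borel_lebesgue R n ([set w | enorm w <= r + e]%R `\` [set w | enorm w <= r - e]%R) =
    (borel_lebesgue R n [set w | enorm w <= r + e]%R -
     borel_lebesgue R n ([set w | enorm w <= r + e]%R `&` [set w | enorm w <= r - e]%R))%E.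
  by apply: measureD; [exact: measurable_enorm_le|exact: measurable_enorm_le|].
rewrite (_ : _ `&` _ = [set w | enorm w <= r - e]); last first.
  apply/seteqP; split => w /=; first by case.
  by move=> h; split => //; apply: le_trans h _; lra.
rewrite !borel_lebesgue_ball// -/(ball_const n) -EFinB lee_fin -mulrBr -mulrA.
rewrite ler_wpM2l ?ball_const_ge0// subrXX.
rewrite (_ : r + e - (r - e) = 2 * e); last by ring.
rewrite [leRHS]mulrAC [leRHS]mulrC ler_wpM2l//; first by lra.
apply: (@le_trans _ _ (\sum_(i < n) (r + e) ^+ n.-1)).
  apply: ler_sum => i _.
  rewrite -[X in _ <= _ ^+ X](@subnK i n.-1); last by rewrite -ltnS prednK.
  rewrite exprD ler_wpM2l ?(exprn_ge0 _ (ltW re0))//.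
  by rewrite lerXn2r ?nnegrE//; lra.
by rewrite sumr_const card_ord mulr_natl.
Qed.

End annulus.
Arguments annulus {R} n r1 r2.

(** * Normalized measure on the torus and unfolding of lattice sums *)

Section torus.
Context {R : realType} {d : nat} (A : 'M[R]_d).
Hypothesis hA : A \in unitmx.
Let vol : R := `|\det A|.

Lemma covolume_gt0 : 0 < vol.
Proof. by rewrite normr_gt0 -unitfE -unitmxE. Qed.

Lemma covolumeV_ge0 : 0 <= vol^-1.
Proof. by rewrite invr_ge0 ltW// covolume_gt0. Qed.

Let mOm : measurable (fund_domain A : set (Rn R d)).
Proof. by apply: measurable_Rn; exact: measurable_fund_domain. Qed.

(** [torus_measure] rebuilt as a scaled restriction, so that it carries the structure of a
    measure. *)
Definition torus : {measure set (Rn R d) -> \bar R} :=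
  mscale (NngNum covolumeV_ge0) (mrestr (@lebesgue_Rn R d) mOm).

Lemma torus_measureE : torus_measure A = torus.
Proof.
apply/funext => E; rewrite /torus_measure lebesgue_RnE; last exact: measurable_fund_domain.
by rewrite borel_lebesgue_fund_domain.
Qed.

Lemma torus_borel (E : set 'cV[R]_d) : measurable E ->
  torus E = ((vol^-1)%:E * borel_lebesgue R d (E `&` fund_domain A))%E.
Proof.
move=> mE; rewrite /torus /= /mscale /= /mrestr lebesgue_RnE//.
by apply: measurableI => //; exact: measurable_fund_domain.
Qed.

(** The property of [K] that [fund_domain_lattice_bound] provides: up to distance [rho], only
    lattice vectors of the box matter. *)
Definition fund_box (rho : R) (K : nat) := forall x y (z : 'cV[int]_d),
  fund_domain A x -> fund_domain A y -> enorm (y + A *m map_mx intr z - x) <= rho ->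
  exists f : lattice_box d K, box_vec f = z.

Lemma measurable_enorm_shift (a : 'cV[R]_d) (r1 r2 : R) :
  measurable [set y : 'cV[R]_d | r1 < enorm (y + a) <= r2].
Proof.
rewrite (_ : [set y | _] = (fun y => y + a) @^-1` annulus d r1 r2)//.
rewrite -[X in measurable X]setTI.
by apply: measurable_cV_add => //; exact: measurable_annulus.
Qed.

Lemma measurable_enorm_shift_le (a : 'cV[R]_d) (r : R) :
  measurable [set y : 'cV[R]_d | enorm (y + a) <= r].
Proof.
rewrite (_ : [set y | _] = (fun y => y + a) @^-1` [set v | enorm v <= r])//.
rewrite -[X in measurable X]setTI.
by apply: measurable_cV_add => //; exact: measurable_enorm_le.
Qed.

Section unfolding.
Variables (rho : R) (K : nat).
Hypothesis hK : fund_box rho K.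

(** Unfolding: [tile_sum] with the fundamental domain as tile. *)
Lemma torus_sum (t : lattice_box d K -> 'cV[R]_d) (E : set 'cV[R]_d) : measurable E ->
  (forall w, E w -> exists f, fund_domain A (w - t f)) ->
  (forall f g w, fund_domain A (w - t f) -> fund_domain A (w - t g) -> f = g) ->
  (\sum_f torus [set y | E (y + t f)%R] = (vol^-1)%:E * borel_lebesgue R d E)%E.
Proof.
move=> mE cov uniq.
rewrite -(tile_sum (measurable_fund_domain hA) mE cov uniq) ge0_sume_distrr//.
apply: eq_bigr => f _; rewrite torus_borel; first by rewrite setIC.
rewrite -[X in measurable X]setTI.
exact: measurable_cV_add.
Qed.

(** The average of the periodized indicator unfolds to the Lebesgue volume of a single ball: any
    lattice vector bringing a point of that ball into the domain lies in the box. *)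
Lemma torus_ball (x : 'cV[R]_d) (r : R) : (0 < d)%N -> fund_domain A x -> 0 < r <= rho ->
  (\sum_(f : lattice_box d K) torus [set y | enorm (y + lattice_vec A f - x) <= r]%R =
   (ball_volume A r)%:E)%E.
Proof.
move=> d0 Ox /andP[r0 rrho].
pose E := [set w : 'cV[R]_d | enorm (w - x) <= r].
have mE : measurable E by exact: measurable_enorm_shift_le.
rewrite (torus_sum (t := @lattice_vec _ _ A K) mE).
- rewrite (borel_lebesgue_translate (- x) (measurable_enorm_le r)).
  by rewrite borel_lebesgue_ball// -EFinM /ball_volume mulrA.
- move=> w Ew; have [z Oz] := fund_domain_cover hA w.
  have [|f fz] := hK Ox Oz (z := z); last by exists f; rewrite /lattice_vec fz.
  by rewrite subrK; exact: le_trans rrho.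
- by move=> f g w Of Og; apply: box_vec_inj; exact: fund_domain_uniq Of Og.
Qed.

(** The averaged variable is now the centre [x], so the annulus is reflected and the translation
    vectors change sign. *)
Lemma torus_annulus (y : 'cV[R]_d) (r1 r2 : R) : fund_domain A y -> r2 <= rho ->
  (\sum_(f : lattice_box d K) torus [set x | (r1 < enorm (y + lattice_vec A f - x) <= r2)%R] =
   (vol^-1)%:E * borel_lebesgue R d (annulus d r1 r2))%E.
Proof.
move=> Oy rrho.
pose E := [set w : 'cV[R]_d | r1 < enorm (w - y) <= r2].
have mE : measurable E by exact: measurable_enorm_shift.
rewrite (eq_bigr (fun f => torus [set x | E (x + - lattice_vec A f)%R])); last first.
  move=> f _; congr (torus _); apply/seteqP; split => x; rewrite /E/=;
    by rewrite -[enorm (y + _ - _)]enormN opprB opprD addrA addrAC.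
rewrite (torus_sum (t := fun f => - lattice_vec A f) mE).
- by rewrite (borel_lebesgue_translate (- y) (measurable_annulus r1 r2)).
- move=> w /andP[_ Ew]; have [z Oz] := fund_domain_cover hA w.
  have [|f fz] := hK Oz Oy (z := - z).
    rewrite map_mxN mulmxN opprB addrA subrK -enormN opprB.
    exact: le_trans rrho.
  by exists f; rewrite opprK /lattice_vec fz map_mxN mulmxN.
- have lattice_vecN (z : 'cV[int]_d) : - (A *m map_mx intr z) = A *m map_mx intr (- z).
    by rewrite map_mxN mulmxN.
  move=> f g w; rewrite /lattice_vec (lattice_vecN (box_vec f)) (lattice_vecN (box_vec g)).
  move=> Of Og.
  by apply: box_vec_inj; apply: oppr_inj; exact: fund_domain_uniq Of Og.
Qed.

End unfolding.

End torus.

Lemma indic_mkset (R : pzRingType) (T : Type) (p : T -> bool) (x : T) :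
  \1_[set y | p y] x = (p x)%:R :> R.
Proof. by rewrite indicE; congr ((_ : bool)%:R); apply/idP/idP; rewrite inE. Qed.

(** * Number variance of jittered sampling for fixed [N] and radius *)

Section jittered_variance.
Context {R : realType} {d : nat} (A : 'M[R]_d).
Hypotheses (hA : A \in unitmx) (d0 : (0 < d)%N).
Variables (N : nat) (P : 'I_N -> set (Rn R d)).
Hypothesis N0 : (0 < N)%N.
Hypotheses (mP : forall j, measurable (P j)) (tP : trivIset setT P).
Hypothesis coverP : \bigcup_j P j = fund_domain A.
Hypothesis muP : forall j, torus_measure A (P j) = (N%:R^-1)%:E.
Variables (rho : R) (K : nat).
Hypothesis hK : fund_box A rho K.

Let mu := torus hA.

(** A crude bound for the counting function: at most one hit per vector of the box. *)
Let M : R := #|{: lattice_box d K}|%:R.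

Definition jittered_measure (j : 'I_N) : {measure set (Rn R d) -> \bar R} :=
  mscale (NngNum (ler0n R N)) (mrestr mu (mP j)).

Lemma jittered_lawE : jittered_law A P = (fun j => jittered_measure j).
Proof.
by apply/funext => j; apply/funext => E; rewrite /jittered_law (torus_measureE hA).
Qed.

Lemma jittered_measure1 j : jittered_measure j (P j) = 1%E.
Proof.
rewrite /jittered_measure /= /mscale /= /mrestr setIid /mu -(torus_measureE hA) muP.
by rewrite -EFinM mulfV// pnatr_eq0 -lt0n.
Qed.

Lemma part_fund_domain j : P j `<=` fund_domain A.
Proof. by move=> x Px; rewrite -coverP; exists j. Qed.

Lemma part_neq0 j : P j !=set0.
Proof.
apply/set0P/eqP => P0; have := jittered_measure1 j; rewrite P0 measure0.
by case=> /eqP; rewrite eq_sym oner_eq0.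
Qed.

Lemma torus_fund_domain (E : set (Rn R d)) : mu (E `&` fund_domain A) = mu E.
Proof. by rewrite /mu /= /mscale /= /mrestr -setIA setIid. Qed.

Lemma torus_parts (E : set (Rn R d)) : measurable E ->
  (\sum_j mu (E `&` P j) = mu E)%E.
Proof.
move=> mE; rewrite -[RHS]torus_fund_domain -coverP setI_bigcupr measure_bigcup_finType//.
  by move=> j; exact: measurableI.
exact: trivIset_setIl.
Qed.

(** A measurable substitute for [ball_indicator], equal to it for points and centres in the
    fundamental domain and radii up to [rho]. *)
Let count (x : 'cV[R]_d) (r : R) (y : 'cV[R]_d) : R :=
  \sum_(f : lattice_box d K) (enorm (y + lattice_vec A f - x) <= r)%R%:R.

Let ball (x : 'cV[R]_d) (r : R) (f : lattice_box d K) : set (Rn R d) :=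
  [set y | enorm (y + lattice_vec A f - x) <= r].

Let mball x r f : measurable (ball x r f).
Proof.
apply: measurable_Rn; rewrite /ball.
under eq_set do rewrite -addrA; exact: measurable_enorm_shift_le.
Qed.

Let countE x r y : count x r y = \sum_f \1_(ball x r f) y.
Proof. by apply: eq_bigr => f _; rewrite /ball indic_mkset. Qed.

Let measurable_count x r (D : set (Rn R d)) : measurable_fun D (count x r).
Proof.
apply: measurable_funTS.
rewrite (_ : count x r = fun y => \sum_f \1_(ball x r f) y); last exact/funext/countE.
by apply: measurable_fun_sumr => f; exact: measurable_indic.
Qed.

Let count_bound x r y : `|count x r y| <= M.
Proof.
rewrite ger0_norm ?sumr_ge0// /M -sumr_const; apply: ler_sum => f _.
by case: (_ <= r).
Qed.

Section fixed_center.
Variables (x : 'cV[R]_d) (r : R).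
Hypotheses (Ox : fund_domain A x) (r0 : 0 < r) (rrho : r <= rho).

Let ind := ball_indicator A x r.

Let indE j y : P j y -> ind y = count x r y.
Proof.
move=> /part_fund_domain Oy; apply: ball_indicator_sum => // z h.
by apply: (hK Ox Oy); exact: le_trans rrho.
Qed.

Let measurable_ind j : measurable_fun (P j) ind.
Proof.
apply: (@eq_measurable_fun _ _ _ _ (P j) (count x r) ind); last exact: measurable_count.
by move=> y /[!inE] /indE ->.
Qed.

Let ind_bound j y : P j y -> `|ind y| <= M.
Proof. by move=> /indE ->. Qed.

Let meanE j : (mean (jittered_measure j) (P j) ind)%:E =
  (N%:R%:E * \sum_f mu (ball x r f `&` P j))%E.
Proof.
have int_ind : (jittered_measure j).-integrable (P j) (EFin \o ind).
  exact: (bounded_integrable_prob (mP j) (jittered_measure1 j) (@measurable_ind j)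
    (@ind_bound j)).
rewrite /mean fineK; last exact: integrable_fin_num.
transitivity (\int[jittered_measure j]_(y in P j)
    \sum_f (1 * \1_(ball x r f) y)%:E)%E.
  apply: eq_integral => y /[!inE] Py /=; rewrite (indE Py) countE -sumEFin.
  by apply: eq_bigr => f _; rewrite mul1r.
rewrite (ge0_integral_sum_indic _ _ (mP j) ler01 (mball x r)) ge0_sume_distrr; last by [].
apply: eq_bigr => f _; rewrite mul1e.
by rewrite /jittered_measure /= /mscale /= /mrestr -setIA setIid.
Qed.

(** Each law is [N * mu] on its cell, so the sum over the cells is [N] times an integral over the
    torus, evaluated exactly by [torus_ball]. *)
Lemma sum_mean : \sum_j mean (jittered_measure j) (P j) ind = N%:R * ball_volume A r.
Proof.
apply: EFin_inj; rewrite -sumEFin (eq_bigr _ (fun j _ => meanE j)).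
rewrite -ge0_sume_distrr; last by move=> j _; exact: sume_ge0.
rewrite exchange_big/= EFinM; congr (_ * _)%E.
rewrite -(torus_ball hA hK d0 Ox); last by rewrite r0.
by apply: eq_bigr => f _; rewrite torus_parts.
Qed.

Lemma iterated_integral_ind :
  iterated_integral (jittered_law A P) P (fun s =>
    ((\sum_(j < N) ball_indicator A x r (tnth s j) - N%:R * ball_volume A r) ^+ 2)%:E) =
  (\sum_j variance (jittered_measure j) (P j) ind)%:E.
Proof.
rewrite jittered_lawE (iterated_integral_sqr (M := M))//.
- by rewrite sum_mean subrr expr0n addr0.
- exact: jittered_measure1.
Qed.

(** Moving [y] within the cell can change the term of a lattice vector only if the translate of [y0]
    lies within [e] of the sphere of radius [r]; [G] counts these vectors. *)
Lemma variance_ind_le j (y0 : 'cV[R]_d) (e : R) : P j y0 -> 0 <= e ->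
  (forall y, P j y -> enorm (y - y0) <= e) ->
  variance (jittered_measure j) (P j) ind <=
  M *
  \sum_(f : lattice_box d K) (r - e < enorm (y0 + lattice_vec A f - x) <= r + e)%R%:R.
Proof.
move=> Py0 e0 ye; set G := \sum_f _.
have G0 : 0 <= G by apply: sumr_ge0.
have GK : G <= M.
  by rewrite /M -sumr_const; apply: ler_sum => f _; case: (_ < _ <= _).
(* One factor of [G^2] is replaced by [M]; the bound stays linear in [G], so averaging over [x]
   yields an annulus volume. *)
apply: (@le_trans _ _ (G ^+ 2)); last by rewrite expr2 ler_wpM2r.
suff h y : P j y -> `|ind y - ind y0| <= G.
  exact: (variance_le (mP j) (jittered_measure1 j) (@measurable_ind j) (@ind_bound j) h).
move=> Py; rewrite (indE Py) (indE Py0) /count -sumrB.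
rewrite (le_trans (ler_norm_sum _ _ _))//; apply: ler_sum => f _.
set a := enorm (y + _ - _); set b := enorm (y0 + _ - _).
have ab : a <= b + e.
  apply: (@enorm_le_dist _ _ (y + lattice_vec A f - x) (y0 + lattice_vec A f - x)).
  by rewrite opprB addrA subrK [y0 + _]addrC addrKA; exact: ye.
have ba : b <= a + e.
  apply: (@enorm_le_dist _ _ (y0 + lattice_vec A f - x) (y + lattice_vec A f - x)).
  by rewrite opprB addrA subrK [y + _]addrC addrKA -enormN opprB; exact: ye.
(* Only the two cases with [a] and [b] on opposite sides of [r] contribute; there [|a - b| <= e]
   places [b] in the annulus. *)
have [ar|ar] := leP a r; have [br|br] := leP b r; rewrite ?subrr ?normr0 ?ler0n//.
- by rewrite subr0 normr1 (_ : _ && _ = true)//; apply/andP; split; lra.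
- by rewrite sub0r normrN1 (_ : _ && _ = true)//; apply/andP; split; lra.
Qed.

End fixed_center.

Lemma number_variance_le (r e : R) : 0 < r -> 0 <= e -> r + e <= rho ->
  (forall j y y', P j y -> P j y' -> enorm (y - y') <= e) ->
  (0 <= number_variance A P r <=
    (N%:R * (#|{: lattice_box d K}|%:R * (`|\det A|^-1 *
      (ball_const d * (d%:R * (2 * e)) * (r + e) ^+ d.-1))))%:E)%E.
Proof.
move=> r0 e0 rerho diamP.
have rrho : r <= rho by apply: le_trans rerho; rewrite lerDl.
have /choice[y0 Py0] := part_neq0.
pose ann j (f : lattice_box d K) : set (Rn R d) :=
  [set x | r - e < enorm (y0 j + lattice_vec A f - x) <= r + e].
have mann j f : measurable (ann j f).
  apply: measurable_Rn; rewrite /ann.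
  under eq_set do rewrite -enormN opprB; exact: measurable_enorm_shift.
have mOm : measurable (fund_domain A : set (Rn R d)).
  by apply: measurable_Rn; exact: measurable_fund_domain.
rewrite /number_variance (torus_measureE hA) -/mu.
have iterE x : fund_domain A x -> iterated_integral (jittered_law A P) P (fun s =>
    ((\sum_(j < N) ball_indicator A x r (tnth s j) - N%:R * ball_volume A r) ^+ 2)%:E) =
  (\sum_j variance (jittered_measure j) (P j) (ball_indicator A x r))%:E.
  by move=> Ox; exact: iterated_integral_ind.
apply/andP; split.
  apply: integral_ge0 => x Ox; rewrite iterE// lee_fin sumr_ge0// => j _.
  exact: variance_ge0.
apply: (@le_trans _ _ (\int[mu]_(x in fund_domain A)
    \sum_(p : 'I_N * lattice_box d K) (M * \1_(ann p.1 p.2) x)%:E))%E.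
  (* Measurability of the iterated integral in [x] is not established; it is only compared with a
     measurable sum of indicators. *)
  apply: ge0_le_integral_nonmeasurable => x Ox; rewrite iterE//.
    by rewrite lee_fin sumr_ge0// => j _; exact: variance_ge0.
  rewrite sumEFin lee_fin -(pair_bigA _ (fun j f => M * \1_(ann j f) x))/=.
  apply: ler_sum => j _; rewrite -mulr_sumr.
  apply: (le_trans (variance_ind_le Ox rrho (Py0 j) e0 _)).
    by move=> y Py; apply: (diamP j) => //; exact: (Py0 j).
  by rewrite ler_wpM2l//; apply: ler_sum => f _; rewrite /ann indic_mkset.
rewrite (ge0_integral_sum_indic _ _ mOm (ler0n _ _) (fun p => mann p.1 p.2)).
rewrite -(pair_bigA _ (fun j f => M%:E * mu (ann j f `&` fund_domain A)))%E/=.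
rewrite [leRHS](_ : _ = (\sum_(j < N) (M * (`|\det A|^-1 *
      (ball_const d * (d%:R * (2 * e)) * (r + e) ^+ d.-1)))%:E)%E); last first.
  by rewrite sumEFin sumr_const card_ord [in LHS]mulr_natl.
apply: lee_sum => j _.
under eq_bigr do rewrite torus_fund_domain.
rewrite -ge0_sume_distrr// EFinM lee_wpmul2l ?lee_fin//.
have Oy0 : fund_domain A (y0 j) by apply: (@part_fund_domain j); exact: (Py0 j).
rewrite /ann /mu (torus_annulus hA hK (r - e) Oy0 rerho).
rewrite EFinM lee_wpmul2l ?lee_fin ?invr_ge0//.
exact: borel_lebesgue_annulus_le.
Qed.

End jittered_variance.

(** * Upper limits and decay of [N^(-1/d)] *)

Section limits.
Context {R : realType}.

Lemma limn_esup_bounded (u : nat -> \bar R) (c : \bar R) :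
  (\forall n \near \oo, 0 <= u n <= c)%E -> (`|limn_esup u| <= c)%E.
Proof.
move=> uc; rewrite gee0_abs.
  apply: le_trans (ereal_inf_lbound _) _; first by exists [set n | (0 <= u n <= c)%E].
  by apply: ge_ereal_sup => _ [n /andP[_ h] <-].
apply: le_ereal_inf_tmp => _ [V VF <-].
have [n [/andP[un _] Vn]] := filter_ex (filterI uc VF).
by apply: (le_trans un); apply: ereal_sup_ubound; exists n.
Qed.

Lemma natr_powRN_expn (N d : nat) : (0 < d)%N ->
  (N%:R `^ (- d%:R^-1)) ^+ d = N%:R^-1 :> R.
Proof.
move=> d0; rewrite -powR_mulrn ?powR_ge0// -powRrM mulNr mulVf ?pnatr_eq0 -?lt0n//.
by rewrite powR_inv1.
Qed.

(** Both sides are compared after raising to the power [d], which turns [N^(-1/d)] into [1/N]. *)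
Lemma near_natr_powRN_le (d : nat) (a e : R) : (0 < d)%N -> 0 < e ->
  \forall N \near \oo, a * N%:R `^ (- d%:R^-1) <= e.
Proof.
move=> d0 e0; near=> N.
have N0 : 0 < N%:R :> R by rewrite ltr0n; near: N; exact: nbhs_infty_gt.
set q := _ `^ _; have q0 : 0 <= q by exact: powR_ge0.
apply: (@le_trans _ _ (`|a| * q)); first by rewrite ler_wpM2r// ler_norm.
rewrite -(@ler_pXn2r _ d)// ?nnegrE ?mulr_ge0//; last exact: ltW.
rewrite exprMn natr_powRN_expn// ler_pdivrMr// mulrC -ler_pdivrMr ?exprn_gt0//.
near: N; exact: nbhs_infty_ger.
Unshelve. all: by end_near. Qed.

End limits.

(** * The three regimes *)

Section hyperuniform_jittered.
Context {R : realType} {d : nat} (A : 'M[R]_d) (C : R).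
Hypotheses (d0 : (0 < d)%N) (hA : A \in unitmx).
Variable P : forall N : nat, 'I_N -> set (Rn R d).
Arguments P : clear implicits.
Hypothesis hP : forall N : nat, (0 < N)%N -> area_regular_partition A C (P N).

Let delta N : R := C * N%:R `^ (- d%:R^-1).
Let V N r := number_variance A (P N) r.

Lemma enorm_part_le N j (y y' : 'cV[R]_d) : (0 < N)%N ->
  P N j y -> P N j y' -> enorm (y - y') <= delta N.
Proof.
move=> N0 Py Py'; have [_ _ _ _ diamP] := hP N0.
rewrite -lee_fin; apply: le_trans (diamP j).
by apply: ereal_sup_ubound; exists y => //; exists y'.
Qed.

Lemma delta_ge0 N : (0 < N)%N -> 0 <= delta N.
Proof.
move=> N0; have [mP tP cP muP _] := hP N0.
have [y Py] := part_neq0 hA N0 mP muP (Ordinal N0).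
by apply: le_trans (enorm_part_le N0 Py Py); exact: enorm_ge0.
Qed.

(** The case [N = 1], where [delta] equals [C]. *)
Lemma diam_const_ge0 : 0 <= C.
Proof. by have := delta_ge0 (ltn0Sn 0); rewrite /delta powR1 mulr1. Qed.

(** [B] is fixed before [N] and [r], through a box for [rho], so the bound still applies when the
    radius varies with [N]. *)
Lemma number_variance_bound (rho : R) : exists2 B : R, 0 <= B &
  forall N r, (0 < N)%N -> 0 < r -> r + delta N <= rho ->
  (0 <= V N r <= (B * (N%:R * delta N * (r + delta N) ^+ d.-1))%:E)%E.
Proof.
have [K hK] := fund_domain_lattice_bound hA rho.
exists (#|{: lattice_box d K}|%:R * (`|\det A|^-1 * (ball_const d * (d%:R * 2)))).
  rewrite mulr_ge0 ?ler0n// mulr_ge0 ?invr_ge0 ?normr_ge0//.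
  by rewrite mulr_ge0 ?ball_const_ge0 ?mulr_ge0.
move=> N r N0 r0 rrho; have [mP tP cP muP _] := hP N0.
have := number_variance_le hA d0 N0 mP tP cP muP hK r0 (delta_ge0 N0) rrho
  (fun j y y' => @enorm_part_le N j y y' N0).
congr (_ <= _ <= _%:E)%E; ring.
Qed.

(** For fixed [r] the bound is a constant times [N * delta N], and [delta N] tends to 0. *)
Lemma hyperuniform_large : hyperuniform_large_balls A V.
Proof.
move=> r r0 _ e e0.
have [B B0 hB] := number_variance_bound (r + 1).
(* The added 1 keeps [D] positive even if [B] is 0. *)
pose D := B * (r + 1) ^+ d.-1 + 1.
have D0 : 0 < D by rewrite ltr_wpDl// mulr_ge0// exprn_ge0// addr_ge0// ltW.
near=> N.
have N0 : (0 < N)%N by near: N; exact: nbhs_infty_gt.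
have dl0 := delta_ge0 N0.
have d1 : delta N <= 1 by near: N; exact: near_natr_powRN_le.
have d2 : delta N <= e / D.
  by near: N; apply: near_natr_powRN_le => //; exact: divr_gt0.
have /andP[V0 V1] := hB N r N0 r0 (lerD (lexx r) d1).
rewrite gee0_abs//; apply: (le_trans V1); rewrite lee_fin ger0_norm//.
have rd : (r + delta N) ^+ d.-1 <= (r + 1) ^+ d.-1.
  by rewrite lerXn2r ?nnegrE ?addr_ge0 ?lerD2l//; exact: ltW.
apply: (@le_trans _ _ (B * (N%:R * delta N * (r + 1) ^+ d.-1))).
  by rewrite ler_wpM2l// ler_wpM2l// mulr_ge0.
rewrite (_ : B * _ = (delta N * (B * (r + 1) ^+ d.-1)) * N%:R); last by ring.
rewrite ler_wpM2r//; move: d2; rewrite ler_pdivlMr//; apply: le_trans.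
by rewrite ler_wpM2l// lerDl.
Unshelve. all: by end_near. Qed.

(** That [N * Vol(B)] tends to infinity makes [delta N] negligible against [r N]; the bound is then
    a small multiple of [N * (r N)^d]. *)
Lemma hyperuniform_small : hyperuniform_small_balls A V.
Proof.
move=> r r0 rcvg volcvg e e0.
have [B B0 hB] := number_variance_bound 2.
pose k := ball_volume A 1.
have volE s : ball_volume A s = k * s ^+ d by rewrite /k /ball_volume expr1n mulr1.
have k0 : 0 < k.
  rewrite /k /ball_volume expr1n mulr1 mulr_gt0 ?invr_gt0 ?covolume_gt0//.
  exact: ball_const_gt0.
pose D := B * 2 ^+ d.-1 + 1.
have D0 : 0 < D by rewrite ltr_wpDl// mulr_ge0.
(* The target for the ratio of [delta N] to [r N]: at most 1, so that [r N + delta N <= 2 r N], and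
   with [h * D <= e * k], which absorbs all constants. *)
pose h := Num.min 1 (e * k / D).
have h0 : 0 < h by rewrite lt_min ltr01 divr_gt0// mulr_gt0.
have h1 : h <= 1 by rewrite ge_min lexx.
have hD : h * D <= e * k by rewrite -ler_pdivlMr// ge_min lexx orbT.
have C0 := diam_const_ge0.
near=> N.
have N0 : (0 < N)%N by near: N; exact: nbhs_infty_gt.
have dl0 := delta_ge0 N0; have rN0 := r0 N.
have d1 : delta N <= 1 by near: N; exact: near_natr_powRN_le.
have r1 : r N <= 1.
  near: N; have /cvgrPdist_le /(_ _ ltr01) := rcvg.
  by apply: filterS => n; rewrite sub0r normrN; apply: le_trans; exact: ler_norm.
(* Raised to the power [d] and multiplied by [k], this says that [N * ball_volume A (r N)] is at
   least the constant [k * (C^d / h^d)]. *)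
have dr : delta N <= h * r N.
  rewrite -(@ler_pXn2r _ d)// ?nnegrE ?mulr_ge0//; [|exact: ltW|exact: ltW].
  have N0r : 0 < N%:R :> R by rewrite ltr0n.
  rewrite /delta !exprMn natr_powRN_expn// ler_pdivrMr// -mulrA mulrC.
  rewrite -ler_pdivrMr ?exprn_gt0// -(ler_pM2l k0).
  rewrite (_ : k * (r N ^+ d * _) = N%:R * ball_volume A (r N)); last first.
    by rewrite volE; ring.
  by near: N; move/cvgryPge : volcvg; exact.
have /andP[V0 V1] := hB N (r N) N0 rN0 (lerD r1 d1).
rewrite gee0_abs//; apply: (le_trans V1); rewrite lee_fin volE ger0_norm; last first.
  by rewrite mulr_ge0// mulr_ge0 ?exprn_ge0//; exact: ltW.
have rd : (r N + delta N) ^+ d.-1 <= (2 * r N) ^+ d.-1.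
  rewrite lerXn2r ?nnegrE ?addr_ge0 ?mulr_ge0//; try exact: ltW.
  rewrite mulr_natl mulr2n lerD2l (le_trans dr)// ger_pMl//.
apply: (@le_trans _ _ (B * (N%:R * (h * r N) * (2 * r N) ^+ d.-1))).
  rewrite ler_wpM2l// ler_pM ?mulr_ge0 ?exprn_ge0 ?addr_ge0//; try exact: ltW.
  by rewrite ler_wpM2l.
rewrite (_ : B * _ = (h * (B * 2 ^+ d.-1)) * (N%:R * r N ^+ d)); last first.
  have -> : r N ^+ d = r N * r N ^+ d.-1 by rewrite -exprS prednK.
  by rewrite exprMn; move: (2 ^+ _) (r N ^+ d.-1) => a b; ring.
rewrite (_ : e * _ = (e * k) * (N%:R * r N ^+ d)); last by ring.
rewrite ler_wpM2r ?mulr_ge0 ?exprn_ge0//; first exact: ltW.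
by apply: le_trans hD; rewrite ler_wpM2l ?lerDl// ltW.
Unshelve. all: by end_near. Qed.

(** With [q = N^(-1/d)], the radius is [t q] and [delta N] is [C q]; the powers of [q] cancel [N]
    and leave [B * C * (t + C)^(d-1)], where [t + C <= 2 t] once [t >= C]. *)
Lemma hyperuniform_threshold_order : hyperuniform_threshold d V.
Proof.
(* Since [t] is fixed before [N], the quantity [(t + C) q] eventually drops below 1, and [rho = 1]
   serves every [t]. *)
have [B B0 hB] := number_variance_bound 1.
have C0 := diam_const_ge0.
exists (B * (C * 2 ^+ d.-1)); near=> t.
have t0 : 0 < t by near: t; exact: nbhs_pinfty_gt.
have tC : C <= t by near: t; apply: nbhs_pinfty_ge; exact: num_real.
apply: limn_esup_bounded; near=> N.
have N0 : (0 < N)%N by near: N; exact: nbhs_infty_gt.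
have : (t + C) * N%:R `^ (- d%:R^-1) <= 1.
  by near: N; exact: near_natr_powRN_le.
set q := N%:R `^ _; rewrite mulrDl => tq.
have q0 : 0 < q by apply: powR_gt0; rewrite ltr0n.
have /andP[V0 V1] := hB N (t * q) N0 (mulr_gt0 t0 q0) tq.
rewrite V0/=; apply: (le_trans V1); rewrite lee_fin.
have qd : N%:R * (q * q ^+ d.-1) = 1.
  by rewrite -exprS prednK// natr_powRN_expn// mulfV// pnatr_eq0 -lt0n.
rewrite /delta -/q -mulrDl exprMn.
rewrite (_ : B * _ = B * (C * (t + C) ^+ d.-1) * (N%:R * (q * q ^+ d.-1))); last by ring.
rewrite qd mulr1 -!mulrA ler_wpM2l// ler_wpM2l// ger0_norm; last by rewrite exprn_ge0// ltW.
rewrite -exprMn lerXn2r ?nnegrE ?addr_ge0 ?mulr_ge0//; try exact: ltW.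
by rewrite mulr_natl mulr2n lerD2l.
Unshelve. all: by end_near. Qed.

End hyperuniform_jittered.

Theorem theorem5p1 (R : realType) (d : nat) (hd : (0 < d)%N)
    (A : 'M[R]_d) (hA : A \in unitmx) (C : R)
    (P : forall N : nat, 'I_N -> set (Rn R d))
    (hP : forall N : nat, (0 < N)%N -> area_regular_partition A C (P N)) :
  let V := fun N r => number_variance A (P N) r in
  [/\ hyperuniform_large_balls A V,
      hyperuniform_small_balls A V &
      hyperuniform_threshold d V].
Proof.
move=> V; split.
- exact: hyperuniform_large hP.
- exact: hyperuniform_small hP.
- exact: hyperuniform_threshold_order hP.
Qed.
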